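(* The integral transform $\mathcal B^F_{\mathbb H}$ defined on $L^2(\mathbb R,\mathbb H)$ by $$\mathcal B^F_{\mathbb H}(\varphi)(q)=\int_{\mathbb R}\mathcal A^F_{\mathbb H}(q,x)\,\varphi(x)\,dx,\qquad q\in\mathbb H,$$ is an isometric isomorphism mapping the Hilbert space $L^2(\mathbb R,\mathbb H)$ onto the Clifford-Appell Fock space $\mathcal F(\mathbb H)$.
   Context: $\mathbb H$ denotes the quaternions. For $k\ge 0$, $Q_k(q)=\sum_{j=0}^k T^k_j\,q^{k-j}\overline q^{\,j}$ with $T^k_j=\frac{2(k-j+1)}{(k+1)(k+2)}$. The Clifford-Appell Fock space is $\mathcal F(\mathbb H)=\{\sum_{k=0}^\infty Q_k\alpha_k:\ \alpha_k\in\mathbb H,\ \sum_{k=0}^\infty k!|\alpha_k|^2<\infty\}$, with scalar product $\langle\sum Q_k\alpha_k,\sum Q_k\beta_k\rangle_{\mathcal F(\mathbb H)}=\sum_{k=0}^\infty k!\,\overline{\alpha_k}\beta_k$. $L^2(\mathbb R,\mathbb H)$ is the right quaternionic Hilbert space of square integrable $\mathbb H$-valued functions on $\mathbb R$ with norm $\|\varphi\|^2=\int_{\mathbb R}|\varphi(x)|^2dx$. $(\eta_k)_{k\ge 0}$ are the normalized Hermite functions (a real-valued orthonormal basis of $L^2(\mathbb R)$). The kernel is $\mathcal A^F_{\mathbb H}(q,x)=\sum_{k=0}^\infty\frac{Q_k(q)}{\sqrt{k!}}\eta_k(x)$ for $(q,x)\in\mathbb H\times\mathbb R$. *)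

(* Defs.v *)
From HB Require Import structures.
From mathcomp Require Import all_boot all_order all_algebra.
From mathcomp Require Import ring lra.
From mathcomp Require Import all_classical all_reals all_analysis.

Set Implicit Arguments.
Unset Strict Implicit.
Unset Printing Implicit Defensive.

Import Order.TTheory GRing.Theory Num.Theory.
Import numFieldNormedType.Exports.

Local Open Scope classical_set_scope.
Local Open Scope ring_scope.

Section Quaternions.
Variable R : realType.

(* [Quat a b c d] is the quaternion a + b i + c j + d k. *)
Record quat : Type := Quat { qre : R; qi : R; qj : R; qk : R }.

Implicit Types x y z : quat.

Lemma quat_eqP x y : qre x = qre y -> qi x = qi y -> qj x = qj y ->
  qk x = qk y -> x = y.
Proof. by case: x => ????; case: y => ???? /= -> -> -> ->. Qed.

HB.instance Definition _ := gen_eqMixin quat.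
HB.instance Definition _ := gen_choiceMixin quat.

Definition quat_add x y :=
  Quat (qre x + qre y) (qi x + qi y) (qj x + qj y) (qk x + qk y).
Definition quat_opp x := Quat (- qre x) (- qi x) (- qj x) (- qk x).

Let addqA : associative quat_add.
Proof. by move=> x y z; apply: quat_eqP; exact: addrA. Qed.
Let addqC : commutative quat_add.
Proof. by move=> x y; apply: quat_eqP; exact: addrC. Qed.
Let add0q : left_id (Quat 0 0 0 0) quat_add.
Proof. by move=> x; apply: quat_eqP; exact: add0r. Qed.
Let addNq : left_inverse (Quat 0 0 0 0) quat_opp quat_add.
Proof. by move=> x; apply: quat_eqP; exact: addNr. Qed.

HB.instance Definition _ := GRing.isZmodule.Build quat addqA addqC add0q addNq.

Definition quat_mul x y := Quat
  (qre x * qre y - qi x * qi y - qj x * qj y - qk x * qk y)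
  (qre x * qi y + qi x * qre y + qj x * qk y - qk x * qj y)
  (qre x * qj y - qi x * qk y + qj x * qre y + qk x * qi y)
  (qre x * qk y + qi x * qj y - qj x * qi y + qk x * qre y).

Let mulqA : associative quat_mul.
Proof. by move=> x y z; apply: quat_eqP => /=; ring. Qed.
Let mul1q : left_id (Quat 1 0 0 0) quat_mul.
Proof. by move=> x; apply: quat_eqP => /=; ring. Qed.
Let mulq1 : right_id (Quat 1 0 0 0) quat_mul.
Proof. by move=> x; apply: quat_eqP => /=; ring. Qed.
Let mulqDl : left_distributive quat_mul quat_add.
Proof. by move=> x y z; apply: quat_eqP => /=; ring. Qed.
Let mulqDr : right_distributive quat_mul quat_add.
Proof. by move=> x y z; apply: quat_eqP => /=; ring. Qed.
Let oneq_neq0 : Quat 1 0 0 0 != 0.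
Proof. by apply/eqP => -[] /eqP; rewrite oner_eq0. Qed.

HB.instance Definition _ := GRing.Zmodule_isNzRing.Build quat
  mulqA mul1q mulq1 mulqDl mulqDr oneq_neq0.

Definition quat_scale (r : R) x :=
  Quat (r * qre x) (r * qi x) (r * qj x) (r * qk x).

Let scaleqA a b x : quat_scale a (quat_scale b x) = quat_scale (a * b) x.
Proof. by apply: quat_eqP; exact: mulrA. Qed.
Let scale1q : left_id 1 quat_scale.
Proof. by move=> x; apply: quat_eqP; exact: mul1r. Qed.
Let scaleqDr : right_distributive quat_scale +%R.
Proof. by move=> a x y; apply: quat_eqP; exact: mulrDr. Qed.
Let scaleqDl x : {morph quat_scale ^~ x : a b / a + b}.
Proof. by move=> a b; apply: quat_eqP; exact: mulrDl. Qed.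

HB.instance Definition _ := GRing.Zmodule_isLmodule.Build R quat
  scaleqA scale1q scaleqDr scaleqDl.

Let scaleqAl a x y : a *: (x * y) = (a *: x) * y.
Proof. by apply: quat_eqP => /=; ring. Qed.
Let scaleqAr a x y : a *: (x * y) = x * (a *: y).
Proof. by apply: quat_eqP => /=; ring. Qed.

HB.instance Definition _ := GRing.Lmodule_isLalgebra.Build R quat scaleqAl.
HB.instance Definition _ := GRing.Lalgebra_isAlgebra.Build R quat scaleqAr.

Definition quat_conj x := Quat (qre x) (- qi x) (- qj x) (- qk x).

Definition quat_norm x : R :=
  Num.sqrt (qre x ^+ 2 + qi x ^+ 2 + qj x ^+ 2 + qk x ^+ 2).

Let sumsq_ge0 x : 0 <= qre x ^+ 2 + qi x ^+ 2 + qj x ^+ 2 + qk x ^+ 2.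
Proof. by rewrite !addr_ge0 ?sqr_ge0. Qed.

Let normqD x y : quat_norm (x + y) <= quat_norm x + quat_norm y.
Proof.
have sq z : quat_norm z ^+ 2 = qre z ^+ 2 + qi z ^+ 2 + qj z ^+ 2 + qk z ^+ 2.
  by rewrite sqr_sqrtr.
have n0 z : 0 <= quat_norm z by exact: sqrtr_ge0.
rewrite -(@ler_pXn2r _ 2) ?nnegrE ?addr_ge0 // sqrrD !sq /=.
set d := qre x * qre y + qi x * qi y + qj x * qj y + qk x * qk y.
have cs : d <= quat_norm x * quat_norm y.
  apply: (le_trans (ler_norm d)).
  rewrite -(@ler_pXn2r _ 2) ?nnegrE ?mulr_ge0 // real_normK ?num_real //.
  rewrite exprMn !sq /d.
  rewrite -subr_ge0.
  rewrite (_ : _ - _ =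
    (qre x * qi y - qi x * qre y) ^+ 2 + (qre x * qj y - qj x * qre y) ^+ 2
  + (qre x * qk y - qk x * qre y) ^+ 2 + (qi x * qj y - qj x * qi y) ^+ 2
  + (qi x * qk y - qk x * qi y) ^+ 2 + (qj x * qk y - qk x * qj y) ^+ 2);
    last by ring.
  by rewrite !addr_ge0 ?sqr_ge0.
rewrite -subr_ge0 (_ : _ - _ = 2 * (quat_norm x * quat_norm y - d)); last first.
  by rewrite /d; ring.
by rewrite mulr_ge0 // subr_ge0.
Qed.

Let normqZ (r : R) x : quat_norm (r *: x) = `|r| * quat_norm x.
Proof.
rewrite /quat_norm /= -sqrtr_sqr -sqrtrM ?sqr_ge0 //; congr Num.sqrt.
by ring.
Qed.

Let normq0_eq0 x : quat_norm x = 0 -> x = 0.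
Proof.
move=> /eqP; rewrite sqrtr_eq0 => x0.
have {x0}: qre x ^+ 2 + qi x ^+ 2 + qj x ^+ 2 + qk x ^+ 2 == 0.
  by rewrite eq_le x0 sumsq_ge0.
rewrite !paddr_eq0 ?addr_ge0 ?sqr_ge0 // !sqrf_eq0.
by case/andP => /andP[/andP[/eqP a /eqP b] /eqP c] /eqP d; exact: quat_eqP.
Qed.

(* This provides [`|x|] and the topology used for limits and series. *)
HB.instance Definition _ :=
  @Lmodule_isNormed.Build R quat quat_norm normqD normqZ normq0_eq0.

Lemma normqE x :
  `|x| = Num.sqrt (qre x ^+ 2 + qi x ^+ 2 + qj x ^+ 2 + qk x ^+ 2).
Proof. by []. Qed.

End Quaternions.

Section QuaternionValuedFunctions.
Variable R : realType.
Local Notation H := (quat R).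
Local Notation mu := (@lebesgue_measure R).

Definition quat_measurable (f : R -> H) : Prop :=
  [/\ measurable_fun setT (fun x => qre (f x)),
      measurable_fun setT (fun x => qi (f x)),
      measurable_fun setT (fun x => qj (f x)) &
      measurable_fun setT (fun x => qk (f x))].

Definition quat_integrable (f : R -> H) : Prop :=
  [/\ mu.-integrable setT (fun x => (qre (f x))%:E),
      mu.-integrable setT (fun x => (qi (f x))%:E),
      mu.-integrable setT (fun x => (qj (f x))%:E) &
      mu.-integrable setT (fun x => (qk (f x))%:E)].

Definition quat_integral (f : R -> H) : H :=
  Quat (\int[mu]_x qre (f x)) (\int[mu]_x qi (f x))
       (\int[mu]_x qj (f x)) (\int[mu]_x qk (f x)).

(* Representatives of the elements of L^2(R, H): functions, not yet identified
   up to equality almost everywhere. *)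
Definition L2 : set (R -> H) :=
  [set phi | quat_measurable phi /\ (\int[mu]_x (`|phi x| ^+ 2)%:E < +oo)%E].

Definition L2_norm (phi : R -> H) : R := Num.sqrt (\int[mu]_x (`|phi x| ^+ 2)).

End QuaternionValuedFunctions.

Section CliffordAppellFock.
Variable R : realType.
Local Notation H := (quat R).

Definition Tcoef (k j : nat) : R :=
  (2 * (k - j + 1))%:R / ((k + 1) * (k + 2))%:R.

Definition Qpoly (k : nat) (q : H) : H :=
  \sum_(j < k.+1) Tcoef k j *: (q ^+ (k - j) * quat_conj q ^+ j).

Definition fock_expansion (f : H -> H) (alpha : nat -> H) : Prop :=
  (\sum_(0 <= k <oo) (k`!%:R * `|alpha k| ^+ 2)%:E < +oo)%E /\
  forall q, series (fun k => Qpoly k q * alpha k) @ \oo --> f q.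

Definition fock : set (H -> H) :=
  [set f | exists alpha, fock_expansion f alpha].

(* The coefficients of an element of the Fock space are unique, because
   [Qpoly k q = q ^+ k] for real [q]; outside of the Fock space the value is
   meaningless. *)
Definition fock_coef (f : H -> H) : nat -> H := get (fock_expansion f).

Definition fock_inner (f g : H -> H) : H :=
  limn (series (fun k => k`!%:R *: (quat_conj (fock_coef f k) * fock_coef g k))).

Definition fock_norm (f : H -> H) : R := Num.sqrt (qre (fock_inner f f)).

(* Rodrigues' formula (physicists' convention), divided by the L^2 norm
   (2^k k! sqrt pi)^(1/2) of the numerator. *)
Definition hermite_fun (k : nat) (x : R) : R :=
  (-1) ^+ k * expR (x ^+ 2 / 2) * derive1n k (fun t : R => expR (- t ^+ 2)) x
  / Num.sqrt (2 ^+ k * k`!%:R * Num.sqrt pi).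

Definition kernel_term (q : H) (x : R) (k : nat) : H :=
  (hermite_fun k x / Num.sqrt k`!%:R) *: Qpoly k q.

Definition kernelA (q : H) (x : R) : H := limn (series (kernel_term q x)).

Definition transformB (phi : R -> H) (q : H) : H :=
  quat_integral (fun x => kernelA q x * phi x).

End CliffordAppellFock.

(* Main.v *)
Require Import Defs.
From mathcomp Require Import all_boot all_order all_algebra.
From mathcomp Require Import ring lra.
From mathcomp Require Import all_classical all_reals all_analysis.
From mathcomp Require Import measurable_realfun.

Set Implicit Arguments.
Unset Strict Implicit.
Unset Printing Implicit Defensive.

Import Order.TTheory GRing.Theory Num.Theory.
Import numFieldNormedType.Exports.

Local Open Scope classical_set_scope.
Local Open Scope ring_scope.

(** The transform is diagonal. Write eta_k for the Hermite functions and
    c_k = int eta_k phi for the coefficients of phi; integrating the kernel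
    termwise gives
      B phi (q) = sum_k Q_k(q) (c_k / sqrt k!),
    so that the Fock coefficients of B phi are alpha_k = c_k / sqrt k!, and
    sum_k k! |alpha_k|^2 = sum_k |c_k|^2. Everything thus follows from three
    facts.

    - The Fock coefficients of a function are unique
      ([fock_expansion_unique]): at a real point r the polynomial Q_k takes the
      value r^k, so that two expansions of a function are power series with
      the same values.
    - The Hermite functions form an orthonormal basis of L^2(R): the map from
      phi to its coefficients (c_k) is isometric ([hermite_parseval]), has
      trivial kernel ([hermite_complete]) and reaches every square summable
      sequence ([hermite_riesz_fischer]). Since the Hermite functions are real,
      this may be used on each of the four real coordinates of phi.
    - The termwise integration is legitimate ([transform_expansion]): |Q_k(q)|
      is at most |q|^k, and sum_k |q|^k / sqrt k! is finite.

    Orthonormality is algebraic, once one knows that the derivative of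
    p(x) e^(-x^2) has integral zero for every polynomial p. The main point is
    completeness, which is obtained without Fourier analysis. If f in L^2 is
    orthogonal to all Hermite functions, then h(x) = f(x) e^(-x^2 / 4) is
    integrable and orthogonal to p(x) e^(-x^2 / 4) for all polynomials p.
    Expanding exponentials in power series, one sees that h is also orthogonal
    to e^(-a (x - c)^2) for every centre c and arbitrarily large a. The powers
    of such a Gaussian are again Gaussians of this kind, and
    1 - (1 - u^n)^(2^n) tends boundedly to the indicator of u > 1/2 on [0, 1];
    substituting the Gaussian for u shows that h has integral zero on
    arbitrarily small balls around every point, and Lebesgue's differentiation
    theorem yields h = 0 almost everywhere ([gaussian_moments_eq0]).

    Surjectivity rests on the completeness of L^2, in the form of the
    Riesz-Fischer theorem ([riesz_fischer]), valid for every orthonormal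
    sequence on a measure space. *)

(** * Integrals of real-valued functions, and summable series *)

Lemma nneseries_EFin (R : realType) (u : nat -> R) : cvgn (series u) ->
  (\sum_(k <oo) (u k)%:E = (limn (series u))%:E)%E.
Proof.
move=> cu; apply: cvg_lim => //.
under eq_fun do rewrite sumEFin.
by apply: cvg_EFin; [exact: nearW|exact: cu].
Qed.

Section real_integral.
Context d (T : measurableType d) (R : realType).
Variable mu : {measure set T -> \bar R}.
Implicit Types f g : T -> R.

(** Integrability over the whole space, stated on real-valued functions so that
    sums and multiples keep their real form. *)
Definition rintegrable f := mu.-integrable setT (EFin \o f).

Lemma rintegrable_measurable f : rintegrable f -> measurable_fun setT f.
Proof. by move=> /integrableP[/measurable_EFinP]. Qed.

Lemma rintegrableD f g : rintegrable f -> rintegrable g -> rintegrable (fun x => f x + g x).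
Proof. by move=> f1 g1; exact: (integrableD measurableT f1 g1). Qed.

Lemma rintegrableB f g : rintegrable f -> rintegrable g -> rintegrable (fun x => f x - g x).
Proof. by move=> f1 g1; exact: (integrableB measurableT f1 g1). Qed.

Lemma rintegrableZ k f : rintegrable f -> rintegrable (fun x => k * f x).
Proof. by move=> f1; exact: (integrableZl measurableT k f1). Qed.

Lemma rintegrable0 : rintegrable (fun=> 0).
Proof. exact: integrable0. Qed.

Lemma rintegrable_sum (I : Type) (s : seq I) (F : I -> T -> R) :
  (forall i, rintegrable (F i)) -> rintegrable (fun x => \sum_(i <- s) F i x).
Proof.
move=> iF; elim: s => [|i s ih]; first by under eq_fun do rewrite big_nil; exact: rintegrable0.
by under eq_fun do rewrite big_cons; exact: rintegrableD.
Qed.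

Lemma rintegrable_dominated f g : measurable_fun setT f -> rintegrable g ->
  (forall x, `|f x| <= g x) -> rintegrable f.
Proof.
move=> mf ig fg; apply: le_integrable ig => //; first exact/measurable_EFinP.
move=> x _ /=; rewrite lee_fin (le_trans (fg x))//.
exact: ler_norm.
Qed.

Lemma rintegrable_norm f : rintegrable f -> rintegrable (fun x => `|f x|).
Proof.
move=> fi; apply: (@rintegrable_dominated _ (fun x => `|f x|)); last by move=> x; rewrite normr_id.
  by apply: measurableT_comp => //; exact: rintegrable_measurable.
exact: integrable_norm.
Qed.

Lemma RintD f g : rintegrable f -> rintegrable g ->
  \int[mu]_x (f x + g x) = \int[mu]_x f x + \int[mu]_x g x.
Proof. by move=> *; rewrite RintegralD. Qed.

Lemma RintB f g : rintegrable f -> rintegrable g ->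
  \int[mu]_x (f x - g x) = \int[mu]_x f x - \int[mu]_x g x.
Proof. by move=> *; rewrite RintegralB. Qed.

Lemma RintZ k f : rintegrable f -> \int[mu]_x (k * f x) = k * \int[mu]_x f x.
Proof. by move=> *; rewrite RintegralZl. Qed.

Lemma Rint0 : \int[mu]_x (0 : R) = 0.
Proof. by rewrite /Rintegral integral0. Qed.

Lemma Rint_sum (I : Type) (s : seq I) (F : I -> T -> R) :
  (forall i, rintegrable (F i)) ->
  \int[mu]_x (\sum_(i <- s) F i x) = \sum_(i <- s) \int[mu]_x F i x.
Proof.
move=> iF; elim: s => [|i s ih].
  by under eq_Rintegral do rewrite big_nil; rewrite big_nil Rint0.
under eq_Rintegral do rewrite big_cons.
by rewrite big_cons RintD ?ih//; exact: rintegrable_sum.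
Qed.

Lemma le_Rint f g : rintegrable f -> rintegrable g -> (forall x, f x <= g x) ->
  \int[mu]_x f x <= \int[mu]_x g x.
Proof. by move=> fi gi fg; apply: le_Rintegral. Qed.

Lemma Rint_EFin f : rintegrable f -> ((\int[mu]_x f x)%:E = \int[mu]_x (f x)%:E)%E.
Proof. by move=> fi; rewrite /Rintegral fineK//; exact: integrable_fin_num. Qed.

Lemma ge0_rintegrable f : measurable_fun setT f -> (forall x, 0 <= f x) ->
  (\int[mu]_x (f x)%:E < +oo)%E -> rintegrable f.
Proof.
move=> mf f0 foo; apply/integrableP; split; first exact/measurable_EFinP.
by under eq_integral do rewrite /= ger0_norm//.
Qed.

Lemma ge0_rintegrable_lty f : (forall x, 0 <= f x) -> rintegrable f ->
  (\int[mu]_x (f x)%:E < +oo)%E.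
Proof.
move=> f0 /integrableP[_]; under eq_integral do rewrite /= ger0_norm//.
by [].
Qed.

Lemma dominated_cvg_Rint_ae (f_ : nat -> T -> R) f g :
  (forall n, measurable_fun setT (f_ n)) -> measurable_fun setT f -> rintegrable g ->
  (forall n x, `|f_ n x| <= g x) ->
  {ae mu, forall x, f_ n x @[n --> \oo] --> f x} ->
  rintegrable f /\ \int[mu]_x f_ n x @[n --> \oo] --> \int[mu]_x f x.
Proof.
move=> mf_ mf ig fg cf.
have ifn n : rintegrable (f_ n) by exact: rintegrable_dominated ig (fg n).
have [] := @dominated_convergence _ _ _ mu setT measurableT
  (fun n => EFin \o f_ n) (EFin \o f) (EFin \o g).
- by move=> n; exact/measurable_EFinP.
- exact/measurable_EFinP.
- by apply: filterS cf => x cx _; apply: cvg_EFin => //; exact: nearW.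
- exact: ig.
- by apply: aeW => x n _ /=; rewrite lee_fin.
move=> fi _ h; split=> //.
by apply: fine_cvg; rewrite -/(Rintegral _ _ _) Rint_EFin.
Qed.

Lemma dominated_cvg_Rint (f_ : nat -> T -> R) f g :
  (forall n, measurable_fun setT (f_ n)) -> rintegrable g ->
  (forall n x, `|f_ n x| <= g x) ->
  (forall x, f_ n x @[n --> \oo] --> f x) ->
  rintegrable f /\ \int[mu]_x f_ n x @[n --> \oo] --> \int[mu]_x f x.
Proof.
move=> mf_ ig fg cf; apply: (dominated_cvg_Rint_ae mf_ _ ig fg); last exact: aeW.
by apply: (measurable_fun_cvg mf_) => x _; exact: cf.
Qed.

Lemma Rint_ae_eq f g : measurable_fun setT f -> measurable_fun setT g ->
  f = g %[ae mu] -> \int[mu]_x f x = \int[mu]_x g x.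
Proof.
move=> mf mg fg; congr fine; apply: ae_eq_integral => //.
- exact/measurable_EFinP.
- exact/measurable_EFinP.
- by apply: filterS fg => x + _ => /(_ I) ->.
Qed.

(** The sum of the norms is integrable by monotone convergence, and dominates
    all partial sums; it may be infinite on a null set, hence the detour through
    extended reals. *)
Lemma Rint_series (F : nat -> T -> R) f : (forall k, rintegrable (F k)) ->
  cvgn (series (fun k => \int[mu]_x `|F k x|)) ->
  (forall x, series (F ^~ x) n @[n --> \oo] --> f x) ->
  rintegrable f /\ series (fun k => \int[mu]_x F k x) @ \oo --> \int[mu]_x f x.
Proof.
move=> iF cF Ff.
pose g x := (\sum_(k <oo) `|F k x|%:E)%E.
have mF k : measurable_fun setT (fun x => `|F k x|%:E).
  by apply/measurable_EFinP/rintegrable_measurable/rintegrable_norm.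
have mS n : measurable_fun setT (fun x => series (F ^~ x) n).
  by apply: measurable_sum => k; exact: rintegrable_measurable.
have g0 x : (0 <= g x)%E by apply: nneseries_ge0 => k _ _; rewrite lee_fin.
have ig : mu.-integrable setT g.
  apply/integrableP; split; first by apply: ge0_emeasurable_sum => // k x _ _; rewrite lee_fin.
  under eq_integral do rewrite gee0_abs//.
  rewrite integral_nneseries//.
  under eq_eseriesr do rewrite -Rint_EFin ?rintegrable_norm//.
  by rewrite nneseries_EFin ?ltry.
have [] := @dominated_convergence _ _ _ mu setT measurableT
  (fun n x => (series (F ^~ x) n)%:E) (EFin \o f) g.
- by move=> n; exact/measurable_EFinP.
- by apply/measurable_EFinP/(measurable_fun_cvg mS) => x _; exact: Ff.
- by apply: aeW => x _; apply: cvg_EFin; [exact: nearW|exact: Ff].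
- exact: ig.
- apply: aeW => x n _; apply: (@le_trans _ _ (\sum_(0 <= k < n) `|F k x|)%:E).
    by rewrite lee_fin ler_norm_sum.
  by rewrite -sumEFin; apply: nneseries_lim_ge => k _ _; rewrite lee_fin.
move=> fi _ h; split=> //.
have -> : series (fun k => \int[mu]_x F k x) = (fun n => \int[mu]_x series (F ^~ x) n).
  by apply/funext => n; rewrite /series /= Rint_sum.
apply: (@fine_cvg _ _ _ _ (fun n => \int[mu]_x (series (F ^~ x) n)%:E)%E).
by rewrite Rint_EFin.
Qed.

End real_integral.

Lemma cvg0_dominated (R : realType) (u v : nat -> R) :
  (forall n, `|u n| <= v n) -> v n @[n --> \oo] --> 0 -> u n @[n --> \oo] --> 0.
Proof.
move=> uv v0.
apply/(@cvgr0Pnorm_lt _ R^o _ _ _ u) => e e0.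
have [N _ hN] := @cvgr0_norm_lt _ R^o _ _ _ v v0 e e0; exists N => // n Nn.
apply: le_lt_trans (hN n Nn); rewrite (le_trans (uv n))//; exact: ler_norm.
Qed.

Lemma cvg_series_half (R : realType) : cvgn (series (fun j => 2^-1 ^+ j : R)).
Proof.
have := @is_cvg_geometric_series R 1 2^-1.
rewrite (_ : geometric _ _ = (fun j => 2^-1 ^+ j)).
  by apply; rewrite ger0_norm ?invr_ge0// invf_lt1// ltr1n.
by apply/funext => j; rewrite /= mul1r.
Qed.

(** The inequality of arithmetic and geometric means, in a form that deduces
    the summability of a sequence from that of its squares with weights p. *)
Lemma le_invD_mul_sqr (R : realType) (p y : R) : 0 < p -> y <= p^-1 + p * y ^+ 2.
Proof.
move=> p0; have [y0|y0] := leP y 0.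
  apply: (le_trans y0); apply: addr_ge0; first by rewrite invr_ge0 ltW.
  by rewrite mulr_ge0 ?sqr_ge0// ltW.
rewrite -subr_ge0.
have -> : p^-1 + p * y ^+ 2 - y = p^-1 * ((1 - p * y) ^+ 2 + p * y).
  by field; rewrite gt_eqF.
apply: mulr_ge0; first by rewrite invr_ge0 ltW.
by apply: addr_ge0; [exact: sqr_ge0|rewrite mulr_ge0// ltW].
Qed.

(** The previous inequality with p = 2^k compares the terms with
    2^-k + (2 r^2)^k / k!. *)
Lemma cvg_series_sqrt_fact (R : realType) (r : R) : 0 <= r ->
  cvgn (series (fun k => r ^+ k / Num.sqrt k`!%:R)).
Proof.
move=> r0; apply: (@series_le_cvg _ _ ((fun k => 2^-1 ^+ k) + exp_coeff (2 * r ^+ 2))).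
- by move=> k; rewrite divr_ge0 ?exprn_ge0 ?sqrtr_ge0.
- by move=> k; apply: addr_ge0; [rewrite exprn_ge0// invr_ge0|rewrite exp_coeff_ge0 ?mulr_ge0 ?sqr_ge0].
- move=> k; have p0 : 0 < 2 ^+ k :> R by rewrite exprn_gt0.
  apply: le_trans (le_invD_mul_sqr _ p0) _; rewrite -exprVn [leRHS]/(_ + _) lerD2l.
  rewrite exprMn exprVn sqr_sqrtr// /exp_coeff /= mulrA exprMn.
  by rewrite -!exprM mulnC.
- by apply: is_cvg_seriesD; [exact: cvg_series_half|exact: is_cvg_series_exp_coeff].
Qed.

Lemma is_cvg_seriesMl (R : realType) (c : R) (u : nat -> R) :
  cvgn (series u) -> cvgn (series (fun k => c * u k)).
Proof. by move=> cu; exact: (is_cvg_seriesZ (k := c) cu). Qed.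

(** * Polynomials against Gaussian weights *)

Section gaussian_weight.
Context (R : realType).
Local Notation mu := (@lebesgue_measure R).
Implicit Types (p : {poly R}) (a b x : R).

Definition gauss a x : R := expR (- (a * x ^+ 2)).

Lemma measurable_gauss a : measurable_fun setT (gauss a).
Proof.
apply: measurableT_comp => //; apply: measurable_funN.
by apply: measurable_funM => //; exact: measurable_funX.
Qed.

Lemma rintegrable_gauss a : 0 < a -> rintegrable mu (gauss a).
Proof.
move=> a0; pose s := Num.sqrt (a *+ 2)^-1.
have s2 : s ^+ 2 = (a *+ 2)^-1 by rewrite sqr_sqrtr// invr_ge0 mulrn_wge0// ltW.
have s0 : s != 0 by rewrite sqrtr_eq0 -ltNge invr_gt0 mulrn_wgt0.
rewrite (_ : gauss a = fun x => (normal_peak s)^-1 * normal_pdf 0 s x).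
  by apply: rintegrableZ; exact: integrable_normal_pdf.
apply/funext => x; have -> : normal_pdf 0 s x = normal_peak s * normal_fun 0 s x.
  by rewrite normal_pdfE.
rewrite mulrA mulVf; last first.
  by rewrite gt_eqF// normal_peak_gt0.
rewrite mul1r /normal_fun /gauss subr0 s2; congr expR.
by field; rewrite gt_eqF.
Qed.

Lemma measurable_horner p : measurable_fun setT (horner p).
Proof. by apply: continuous_measurable_fun; exact: continuous_horner. Qed.

(** By induction on the degree: half of the exponent b absorbs the new factor
    x, and the induction hypothesis uses the other half. *)
Lemma poly_le_expR p b : 0 < b ->
  exists2 C, 0 <= C & forall x, `|p.[x]| <= C * expR (b * x ^+ 2).
Proof.
elim/poly_ind: p b => [|p c ih] b b0.
  by exists 0 => // x; rewrite horner0 normr0 mul0r.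
have b20 : 0 < b / 2 by lra.
have [C C0 hC] := ih _ b20.
pose K := 1 + (b / 2)^-1.
have K0 : 0 <= K by rewrite /K addr_ge0// invr_ge0 ltW.
have hK x : `|x| <= K * expR (b / 2 * x ^+ 2).
  have h1 := expR_ge1Dx (b / 2 * x ^+ 2).
  apply: (@le_trans _ _ (K * (1 + b / 2 * x ^+ 2))); last exact: ler_wpM2l.
  have -> : K * (1 + b / 2 * x ^+ 2) = 1 + x ^+ 2 + (b / 2)^-1 + b / 2 * x ^+ 2.
    by rewrite /K; field; rewrite gt_eqF.
  have i0 : 0 <= (b / 2)^-1 by rewrite invr_ge0 ltW.
  have x0 : 0 <= b / 2 * x ^+ 2 by rewrite mulr_ge0 ?sqr_ge0// ltW.
  have : `|x| <= 1 + x ^+ 2.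
    have := sqr_ge0 (`|x| - 1); rewrite sqrrB expr1n real_normK ?num_real//.
    by have := sqr_ge0 x; nra.
  lra.
exists (C * K + `|c|); first by rewrite addr_ge0// mulr_ge0.
move=> x; rewrite hornerMXaddC (le_trans (ler_normD _ _))// mulrDl lerD//.
  rewrite normrM.
  have -> : b * x ^+ 2 = b / 2 * x ^+ 2 + b / 2 * x ^+ 2 by field.
  by rewrite expRD mulrACA ler_pM.
rewrite -{1}[`|c|]mulr1 ler_wpM2l// -expR0 ler_expR mulr_ge0 ?sqr_ge0//.
exact: ltW.
Qed.

Lemma measurable_poly_gauss p a :
  measurable_fun setT (fun x => p.[x] * gauss a x).
Proof.
by apply: measurable_funM; [exact: measurable_horner|exact: measurable_gauss].
Qed.

Lemma poly_gauss_le p a : 0 < a ->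
  exists2 C, 0 <= C & forall x, `|p.[x] * gauss a x| <= C * gauss (a / 2) x.
Proof.
move=> a0; have a20 : 0 < a / 2 by lra.
have [C C0 hC] := poly_le_expR p a20; exists C => // x.
have -> : gauss (a / 2) x = expR (a / 2 * x ^+ 2) * gauss a x.
  by rewrite /gauss -expRD; congr expR; field.
by rewrite normrM mulrA [`|gauss _ _|]ger0_norm ?expR_ge0// ler_wpM2r ?expR_ge0.
Qed.

Lemma rintegrable_poly_gauss p a : 0 < a -> rintegrable mu (fun x => p.[x] * gauss a x).
Proof.
move=> a0; have [C C0 hC] := poly_gauss_le p a0.
apply: (@rintegrable_dominated _ _ _ mu _ (fun x => C * gauss (a / 2) x)) => //.
  exact: measurable_poly_gauss.
by apply/rintegrableZ/rintegrable_gauss; lra.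
Qed.

Definition gauss_int p : R := \int[mu]_x (p.[x] * gauss 1 x).

Lemma gauss_intD p q : gauss_int (p + q) = gauss_int p + gauss_int q.
Proof.
rewrite /gauss_int -RintD; [|exact: rintegrable_poly_gauss..].
by apply: eq_Rintegral => x _; rewrite hornerD mulrDl.
Qed.

Lemma gauss_intZ c p : gauss_int (c *: p) = c * gauss_int p.
Proof.
rewrite /gauss_int -RintZ; last exact: rintegrable_poly_gauss.
by apply: eq_Rintegral => x _; rewrite hornerZ mulrA.
Qed.

Lemma gauss_int1 : gauss_int 1 = Num.sqrt pi.
Proof.
rewrite /gauss_int /Rintegral.
have -> : (fun x => (((1 : {poly R}).[x] * gauss 1 x)%:E)) = EFin \o @gauss_fun R.
  apply/funext => x; congr (_%:E).
  by rewrite -[1]/(1%:P) hornerC /gauss !mul1r.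
by rewrite integralT_gauss.
Qed.

Lemma is_derive_poly_gauss p x : is_derive x 1 (fun x => p.[x] * gauss 1 x)
  ((p^`() - 2%:R *: ('X * p)).[x] * gauss 1 x).
Proof.
have gE : gauss 1 = expR \o horner (- 'X^2).
  by apply/funext => y; rewrite /gauss /= !hornerE.
rewrite gE.
apply: (@trigger_derive _ (horner p * (expR \o horner (- 'X^2))) x _ _ _).
by rewrite /= /GRing.scale /= derivN derivXn !hornerE /=; ring.
Qed.

Lemma cvg_poly_gauss p a : 0 < a ->
  (p.[n%:R] * gauss a n%:R @[n --> \oo] --> (0 : R)).
Proof.
move=> a0; have [C C0 hC] := poly_gauss_le p a0.
apply: (@cvg0_dominated _ _ (fun n => C * expR (- (a / 2)) ^+ n)) => [n|].
  rewrite (le_trans (hC _))// ler_wpM2l// -expRM_natr ler_expR mulNr lerN2.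
  rewrite ler_wpM2l//; first lra.
  by rewrite -natrX ler_nat; case: n => // n; rewrite expnS leq_pmulr.
rewrite -[X in _ --> X](mulr0 C); apply: cvgMl_tmp.
apply: cvg_expr; rewrite ger0_norm ?expR_ge0// expR_lt1; lra.
Qed.

(** The integrand is the derivative of p(x) e^(-x^2): integrate it over
    [-n, n], and let the boundary terms vanish. This is the integration by parts
    behind the orthogonality of the Hermite polynomials. *)
Lemma gauss_int_deriv p : gauss_int (p^`() - 2%:R *: ('X * p)) = 0.
Proof.
pose f x := (p^`() - 2%:R *: ('X * p)).[x] * gauss 1 x.
pose F x := p.[x] * gauss 1 x.
have fi : rintegrable mu f by exact: rintegrable_poly_gauss.
pose f_ (n : nat) x := f x * \1_(`[- n.+1%:R, n.+1%:R] : set R) x.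
have [_ cf] : rintegrable mu f /\ \int[mu]_x f_ n x @[n --> \oo] --> \int[mu]_x f x.
  apply: (@dominated_cvg_Rint _ _ _ mu f_ f (fun x => `|f x|)).
  - by move=> n; apply: measurable_funM; [exact: rintegrable_measurable fi|exact: measurable_indic].
  - exact: rintegrable_norm.
  - move=> n x; rewrite normrM -[leRHS]mulr1 ler_wpM2l// indicE.
    by case: (_ \in _); rewrite ?normr1 ?normr0.
  - move=> x; apply: (@cvg_near_cst _ R).
    near=> n; rewrite /f_ indicE mem_set ?mulr1//= in_itv /= -ler_norml.
    rewrite (le_trans _ (_ : n%:R <= _)) ?ler_nat//.
    by near: n; exact: nbhs_infty_ger.
rewrite -[LHS]/(\int[mu]_x f x).
have {cf} cF : F n.+1%:R - F (- n.+1%:R) @[n --> \oo] --> \int[mu]_x f x.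
  apply: cvg_trans cf; apply: near_eq_cvg; near=> n.
  have -> : \int[mu]_x f_ n x = \int[mu]_(x in `[- n.+1%:R, n.+1%:R]) f x.
    by rewrite [RHS]Rintegral_mkcond patch_indic.
  have cp q y : {for y, continuous (fun x => q.[x] * gauss 1 x)}.
    apply: differentiable_continuous; apply/derivable1_diffP.
    exact: (@ex_derive _ _ _ _ _ _ _ (is_derive_poly_gauss q y)).
  rewrite /Rintegral (@continuous_FTC2 _ f F) //.
  - by apply: (@lt_trans _ _ 0); rewrite ?oppr_lt0 ltr0n.
  - by apply: continuous_subspaceT => x; exact: cp.
  - split.
    + by move=> x _; exact: (@ex_derive _ _ _ _ _ _ _ (is_derive_poly_gauss p x)).
    + by apply: cvg_at_right_filter; exact: cp.
    + by apply: cvg_at_left_filter; exact: cp.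
  - by move=> x _; rewrite derive1E; exact: (@derive_val _ _ _ _ _ _ _ (is_derive_poly_gauss p x)).
have c0 : F n.+1%:R - F (- n.+1%:R) @[n --> \oo] --> (0 - 0 : R).
  have FN y : F (- y) = (p \Po (- 'X)).[y] * gauss 1 y.
    by rewrite /F /gauss sqrrN horner_comp !hornerE.
  apply: cvgB.
    by rewrite (cvg_shiftS (fun n => F n%:R)); exact: cvg_poly_gauss.
  have := cvg_poly_gauss (p \Po (- 'X)) ltr01; rewrite -cvg_shiftS.
  by under eq_fun do rewrite -FN.
by rewrite -(cvg_lim _ cF)// (cvg_lim _ c0)// subr0.
Unshelve. all: by end_near. Qed.
End gaussian_weight.

(** * Hermite polynomials and Hermite functions *)

Section hermite.
Context (R : realType).
Local Notation mu := (@lebesgue_measure R).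
Implicit Types (p q : {poly R}) (x : R).

Fixpoint hermite_poly (n : nat) : {poly R} :=
  if n is m.+1 then 2%:R *: ('X * hermite_poly m) - (hermite_poly m)^`() else 1.
Local Notation H := hermite_poly.

Lemma hermite_polyS n : H n.+1 = 2%:R *: ('X * H n) - (H n)^`().
Proof. by []. Qed.

(** Rodrigues' formula: differentiating H_n(x) e^(-x^2) applies, up to sign,
    the recursion of the Hermite polynomials to H_n. *)
Lemma derive1n_gauss n :
  derive1n n (fun t : R => expR (- t ^+ 2)) =
  fun x => ((-1) ^+ n *: H n).[x] * gauss 1 x.
Proof.
elim: n => [|n ih].
  by rewrite derive1n0; apply/funext => x; rewrite expr0 scale1r /= hornerC mul1r /gauss mul1r.
rewrite derive1nS ih; apply/funext => x; rewrite derive1E.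
rewrite (@derive_val _ _ _ _ _ _ _ (is_derive_poly_gauss _ x)).
congr (_.[x] * _).
rewrite derivZ -scalerAr scalerA mulrC -scalerA -scalerBr exprSr -scalerA hermite_polyS.
by rewrite scaleN1r opprB.
Qed.

Definition hermite_norm n : R := Num.sqrt (2 ^+ n * n`!%:R * Num.sqrt pi).

Lemma hermite_norm_gt0 n : 0 < hermite_norm n.
Proof.
by rewrite sqrtr_gt0 !mulr_gt0 ?exprn_gt0 ?ltr0n ?fact_gt0 ?sqrtr_gt0 ?pi_gt0.
Qed.

Lemma hermite_normE n : hermite_norm n ^+ 2 = 2 ^+ n * n`!%:R * Num.sqrt pi.
Proof. by rewrite sqr_sqrtr// !mulr_ge0// sqrtr_ge0. Qed.

Lemma hermite_normS n :
  hermite_norm n.+1 = hermite_norm n * Num.sqrt (n.+1.*2)%:R.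
Proof.
rewrite /hermite_norm -sqrtrM; last by rewrite !mulr_ge0// sqrtr_ge0.
congr Num.sqrt; rewrite factS natrM exprS -muln2 natrM; ring.
Qed.

Lemma hermite_funE n x :
  hermite_fun n x = (hermite_norm n)^-1 * ((H n).[x] * gauss 2^-1 x).
Proof.
rewrite /hermite_fun derive1n_gauss hornerZ -/(hermite_norm n).
have -> : gauss 2^-1 x = expR (x ^+ 2 / 2) * gauss 1 x.
  by rewrite /gauss -expRD; congr expR; field.
rewrite [RHS]mulrC; congr (_ / _).
rewrite -!mulrA [_ * (_ * (_ * _))]mulrCA; rewrite [in RHS]mulrCA; congr (_ * _).
by rewrite !mulrA -exprMn mulrNN mulr1 expr1n mul1r.
Qed.

Lemma measurable_hermite_fun n : measurable_fun setT (hermite_fun n : R -> R).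
Proof.
rewrite (_ : hermite_fun n = fun x => (hermite_norm n)^-1 * ((H n).[x] * gauss 2^-1 x)).
  by apply: measurable_funM => //; exact: measurable_poly_gauss.
by apply/funext => x; rewrite hermite_funE.
Qed.

Lemma hermite_poly_top n : (H n)`_n = 2 ^+ n /\ (size (H n) <= n.+1)%N.
Proof.
elim: n => [|n [cn sn]]; first by rewrite /= coefC size_poly1.
rewrite hermite_polyS coefB coefZ coefXM /= cn coef_deriv.
rewrite [X in X *+ n.+2]nth_default ?(leq_trans sn)// mul0rn subr0 exprS; split => //.
rewrite (leq_trans (size_polyD _ _))// geq_max size_polyN; apply/andP; split.
  rewrite (leq_trans (size_scale_leq _ _))// (leq_trans (size_polyMleq _ _))//.
  by rewrite size_polyX.
rewrite (leq_trans (size_poly _ _))// (leq_trans (leq_pred _))//.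
by rewrite (leq_trans sn).
Qed.

(** Modulo derivatives of p(x) e^(-x^2), multiplication by the next Hermite
    polynomial moves one derivative onto the other factor. *)
Lemma gauss_int_hermite p n : gauss_int (p * H n) = gauss_int (p^`(n)).
Proof.
elim: n p => [|n ih] p; first by rewrite mulr1 derivn0.
rewrite derivSn -ih hermite_polyS.
have e : p * (2%:R *: ('X * H n) - (H n)^`()) =
         p^`() * H n + (-1) *: ((p * H n)^`() - 2%:R *: ('X * (p * H n))).
  rewrite derivM scaleN1r opprB mulrBr -!scalerAr mulrCA; ring.
by rewrite e gauss_intD gauss_intZ gauss_int_deriv mulr0 addr0.
Qed.

(** Moving all derivatives to the factor of lower degree kills it; in equal
    degrees they leave the constant 2^n n!. *)
Lemma gauss_int_hermite_hermite m n :
  gauss_int (H m * H n) = (hermite_norm n ^+ 2) *+ (m == n).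
Proof.
wlog mn : m n / (m <= n)%N.
  move=> hw; case: (leqP m n) => [/hw//|/ltnW/hw].
  rewrite mulrC eq_sym => ->; case: eqP => // -> //.
have [cm sm] := hermite_poly_top m.
rewrite gauss_int_hermite; have [<-|mn'] := eqVneq m n; last first.
  have -> : (H m)^`(n) = 0 * 1.
    apply/polyP => i; rewrite mul0r coef_derivn nth_default ?mul0rn ?coef0//.
    by rewrite (leq_trans sm)// (leq_trans _ (leq_addr _ _))// ltn_neqAle mn'.
  by rewrite mul0r -(scale0r 1) gauss_intZ mul0r mulr0n.
have -> : (H m)^`(m) = (2 ^+ m * m`!%:R) *: 1.
  apply/polyP => i; rewrite coef_derivn coefZ coef1.
  case: i => [|i]; first by rewrite addn0 cm ffactnn mulr1 mulr_natr.
  by rewrite nth_default ?mul0rn ?mulr0// (leq_trans sm)// -addSnnS leq_addr.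
by rewrite gauss_intZ gauss_int1 hermite_normE mulr1n.
Qed.

Lemma hermite_fun_prod m n x : hermite_fun m x * hermite_fun n x =
  ((hermite_norm m)^-1 * (hermite_norm n)^-1) * ((H m * H n).[x] * gauss 1 x).
Proof.
rewrite !hermite_funE hornerM.
have -> : gauss 1 x = gauss 2^-1 x * gauss 2^-1 x.
  by rewrite /gauss -expRD; congr expR; field.
by ring.
Qed.

Lemma rintegrable_hermite_fun_prod m n :
  rintegrable mu (fun x => hermite_fun m x * hermite_fun n x).
Proof.
under eq_fun do rewrite hermite_fun_prod.
by apply: rintegrableZ; exact: rintegrable_poly_gauss.
Qed.

Lemma hermite_orthonormal m n :
  \int[mu]_x (hermite_fun m x * hermite_fun n x) = (m == n)%:R.
Proof.
under eq_Rintegral do rewrite hermite_fun_prod.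
rewrite RintZ; last exact: rintegrable_poly_gauss.
rewrite -/(gauss_int _) gauss_int_hermite_hermite; case: eqP => [->|_].
  by rewrite mulr1n -expr2 -exprMn mulVf ?expr1n// gt_eqF ?hermite_norm_gt0.
by rewrite mulr0n mulr0.
Qed.

Lemma deriv_hermite_poly n : (H n.+1)^`() = (n.+1.*2)%:R *: H n.
Proof.
elim: n => [|n ih].
  by rewrite /= mulr1 derivB derivZ derivX derivC deriv0 subr0.
rewrite hermite_polyS derivB derivZ derivM derivX mul1r ih.
rewrite derivZ -scalerAr.
have -> : 2%:R *: (H n.+1 + (n.+1.*2)%:R *: ('X * H n)) - (n.+1.*2)%:R *: (H n)^`()
  = 2%:R *: H n.+1 + (n.+1.*2)%:R *: H n.+1.
  rewrite [X in _ = _ + _ *: X]hermite_polyS; move: (H n.+1) => h.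
  by rewrite scalerDr scalerBr addrA !scalerA mulrC.
by rewrite -scalerDl -natrD.
Qed.

Lemma hermite_fun_recurrence n x : hermite_fun n.+2 x =
  2 / Num.sqrt (n.+2.*2)%:R * x * hermite_fun n.+1 x
  - Num.sqrt (n.+1.*2)%:R / Num.sqrt (n.+2.*2)%:R * hermite_fun n x.
Proof.
rewrite !hermite_funE hermite_polyS deriv_hermite_poly.
rewrite hornerD hornerN !hornerZ hornerM hornerX.
rewrite [in LHS]hermite_normS !hermite_normS.
set s := Num.sqrt (n.+1.*2)%:R; set t := Num.sqrt (n.+2.*2)%:R.
have -> : (n.+1.*2)%:R = s ^+ 2 by rewrite sqr_sqrtr.
have s0 : s != 0 by rewrite sqrtr_eq0 -ltNge.
have t0 : t != 0 by rewrite sqrtr_eq0 -ltNge.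
have h0 : hermite_norm n != 0 by rewrite gt_eqF ?hermite_norm_gt0.
by field; rewrite s0 t0 h0.
Qed.

(** At a fixed point the Hermite functions grow at most geometrically in the
    index: both coefficients of the recurrence are at most 1. *)
Lemma hermite_fun_bound n x : `|hermite_fun n x| <=
  `|hermite_fun 0 x| * (2 * `|x| + 1) ^+ n.
Proof.
set A := 2 * `|x| + 1.
have x0 : 0 <= `|x| by [].
have A1 : 1 <= A by rewrite /A lerDr mulr_ge0.
have A0 : 0 <= A by rewrite (le_trans _ A1).
suff : `|hermite_fun n x| <= `|hermite_fun 0 x| * A ^+ n /\
       `|hermite_fun n.+1 x| <= `|hermite_fun 0 x| * A ^+ n.+1 by case.
elim: n => [|n [ih1 ih2]].
  rewrite expr0 mulr1; split=> //; rewrite !hermite_funE hermite_normS expr1.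
  have -> : (H 1).[x] = 2 * x.
    by rewrite hermite_polyS mulr1 derivC subr0 hornerZ hornerX.
  rewrite hornerC mul1r -[1.*2]/2%N.
  set h := hermite_norm 0; set g := gauss _ _.
  have s1 : 1 <= Num.sqrt (2%:R : R) by rewrite -{1}(sqrtr1 R) ler_wsqrtr// (ler_nat R 1 2).
  have s0 : Num.sqrt (2%:R : R) != 0 by rewrite gt_eqF// (lt_le_trans ltr01).
  have -> : (h * Num.sqrt 2)^-1 * (2 * x * g) = (h^-1 * g) * (2 * x / Num.sqrt 2).
    by field; rewrite s0 gt_eqF// hermite_norm_gt0.
  rewrite normrM ler_wpM2l// !normrM [`|2|]ger0_norm// normfV.
  rewrite [`|Num.sqrt _|]ger0_norm ?sqrtr_ge0//.
  apply: (@le_trans _ _ (2 * `|x|)); last by rewrite lerDl.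
  by rewrite ler_pdivrMr ?(lt_le_trans ltr01)// ler_peMr ?mulr_ge0.
split=> //; rewrite hermite_fun_recurrence.
set s := Num.sqrt (n.+1.*2)%:R; set t := Num.sqrt (n.+2.*2)%:R.
have t0 : 0 < t by rewrite sqrtr_gt0.
have s0 : 0 <= s by rewrite sqrtr_ge0.
have st : s / t <= 1.
  by rewrite ler_pdivrMr// mul1r ler_wsqrtr// ler_nat leq_double.
have t2 : 2 / t <= 1.
  rewrite ler_pdivrMr// mul1r -[leLHS]gtr0_norm// -sqrtr_sqr ler_wsqrtr//.
  by rewrite -natrX ler_nat -muln2.
have t20 : 0 <= 2 / t by rewrite divr_ge0// ltW.
have st0 : 0 <= s / t by rewrite divr_ge0// ltW.
rewrite (le_trans (ler_normB _ _))// (normrM (2 / t * x)) (normrM (2 / t)).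
rewrite (normrM (s / t)) (ger0_norm t20) (ger0_norm st0).
have h0 : 0 <= `|hermite_fun 0 x| * A ^+ n by rewrite mulr_ge0// exprn_ge0.
apply: (@le_trans _ _ (`|x| * (`|hermite_fun 0 x| * A ^+ n.+1) +
                      `|hermite_fun 0 x| * A ^+ n)).
  apply: lerD; first by apply: ler_pM => //; [rewrite mulr_ge0|rewrite ler_piMl].
  by rewrite -[leRHS]mul1r ler_pM.
rewrite !exprS.
have -> : `|x| * (`|hermite_fun 0 x| * (A * A ^+ n)) + `|hermite_fun 0 x| * A ^+ n
  = (`|hermite_fun 0 x| * A ^+ n) * (`|x| * A + 1) by ring.
have -> : `|hermite_fun 0 x| * (A * (A * A ^+ n)) =
   (`|hermite_fun 0 x| * A ^+ n) * (A * A) by ring.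
rewrite ler_wpM2l//; rewrite /A; nra.
Qed.

(** Each degree is reached by one Hermite polynomial, so leading terms can be
    removed one after the other. *)
Lemma hermite_poly_span (P : {poly R} -> Prop) :
  (forall p q, P p -> P q -> P (p + q)) -> (forall c p, P p -> P (c *: p)) ->
  (forall n, P (H n)) -> forall p, P p.
Proof.
move=> PD PZ PH p; elim: (size p) {-2}p (leqnn (size p)) => {p} [p|n ih p sp].
  by rewrite leqn0 size_poly_eq0 => /eqP ->; rewrite -(scale0r (H 0)); exact: PZ.
have [cn sn] := hermite_poly_top n.
have c0 : (2 ^+ n : R) != 0 by rewrite expf_neq0.
pose c := p`_n / 2 ^+ n.
rewrite -(subrK (c *: H n) p); apply: PD; last exact: PZ.
apply/ih/leq_sizeP => i; rewrite leq_eqVlt => /predU1P[<-|ni].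
  by rewrite coefB coefZ cn /c divfK// subrr.
by rewrite coefB coefZ !nth_default ?mulr0 ?subr0// (leq_trans _ ni).
Qed.

End hermite.

(** * Square integrable functions *)

Section square_integrable.
Context d (T : measurableType d) (R : realType).
Variable mu : {measure set T -> \bar R}.
Implicit Types f g : T -> R.

Definition sqint f := measurable_fun setT f /\ rintegrable mu (fun x => f x ^+ 2).

Lemma rintegrable_sqintM f g : sqint f -> sqint g -> rintegrable mu (fun x => f x * g x).
Proof.
move=> [mf f2] [mg g2].
apply: (@rintegrable_dominated _ _ _ mu _ (fun x => f x ^+ 2 + g x ^+ 2)).
- exact: measurable_funM.
- exact: rintegrableD.
- move=> x; rewrite ler_norml; have := sqr_ge0 (f x + g x).
  have := sqr_ge0 (f x - g x); have := sqr_ge0 (f x); have := sqr_ge0 (g x).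
  by rewrite sqrrB sqrrD => *; apply/andP; split; lra.
Qed.

Lemma sqintD f g : sqint f -> sqint g -> sqint (fun x => f x + g x).
Proof.
move=> f2 g2; split; first by apply: measurable_funD; [case: f2|case: g2].
have -> : (fun x => (f x + g x) ^+ 2) =
          (fun x => f x ^+ 2 + 2 * (f x * g x) + g x ^+ 2).
  by apply/funext => x; rewrite sqrrD mulr_natl.
by apply: rintegrableD; [apply: rintegrableD; [case: f2|exact/rintegrableZ/rintegrable_sqintM]|case: g2].
Qed.

Lemma sqintZ k f : sqint f -> sqint (fun x => k * f x).
Proof.
move=> [mf f2]; split; first exact: measurable_funM.
by under eq_fun do rewrite exprMn; exact: rintegrableZ.
Qed.

Lemma sqintB f g : sqint f -> sqint g -> sqint (fun x => f x - g x).
Proof.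
move=> f2 g2; under eq_fun do rewrite -mulN1r.
by apply: sqintD => //; exact: sqintZ.
Qed.

Lemma sqint0 : sqint (fun=> 0).
Proof. by split=> //; under eq_fun do rewrite expr0n; exact: rintegrable0. Qed.

Lemma sqint_sum (I : Type) (s : seq I) (F : I -> T -> R) :
  (forall i, sqint (F i)) -> sqint (fun x => \sum_(i <- s) F i x).
Proof.
move=> iF; elim: s => [|i s ih]; first by under eq_fun do rewrite big_nil; exact: sqint0.
by under eq_fun do rewrite big_cons; exact: sqintD.
Qed.

End square_integrable.

(** * Gaussian moments determine an integrable function *)

Section gaussian_moments.
Context (R : realType).
Local Notation mu := (@lebesgue_measure R).
Implicit Types (p q s : {poly R}) (a b c x : R).

Lemma gauss_ge0 a x : 0 <= gauss a x.
Proof. exact: expR_ge0. Qed.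

Lemma gaussD a b x : gauss (a + b) x = gauss a x * gauss b x.
Proof. by rewrite /gauss mulrDl opprD expRD. Qed.

Lemma gaussX a n x : gauss a x ^+ n = gauss (a * n%:R) x.
Proof. by rewrite /gauss -expRM_natr; congr expR; ring. Qed.

Lemma rintegrable_bounded_mul (h g : R -> R) C : rintegrable mu h -> measurable_fun setT g ->
  (forall x, `|g x| <= C) -> rintegrable mu (fun x => h x * g x).
Proof.
move=> hi mg gC; apply: (@rintegrable_dominated _ _ _ mu _ (fun x => C * `|h x|)).
- by apply: measurable_funM => //; exact: rintegrable_measurable hi.
- exact/rintegrableZ/rintegrable_norm.
- by move=> x; rewrite normrM mulrC ler_wpM2r.
Qed.

Lemma gauss_le1 a x : 0 <= a -> gauss a x <= 1.
Proof. by move=> a0; rewrite expR_le1 oppr_le0 mulr_ge0// sqr_ge0. Qed.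

Lemma poly_gauss_bounded p a : 0 < a ->
  exists C, forall x, `|p.[x] * gauss a x| <= C.
Proof.
move=> a0; have [C C0 hC] := poly_gauss_le p a0; exists C => x.
rewrite (le_trans (hC x))// ler_piMr// gauss_le1//; lra.
Qed.

Lemma rintegrable_mul_poly_gauss h p a : 0 < a -> rintegrable mu h ->
  rintegrable mu (fun x => h x * (p.[x] * gauss a x)).
Proof.
move=> a0 hi; have [C hC] := poly_gauss_bounded p a0.
by apply: (rintegrable_bounded_mul hi _ hC); exact: measurable_poly_gauss.
Qed.

Lemma expR_partial_sum (y : R) n : 0 <= y -> \sum_(i < n) y ^+ i / i`!%:R <= expR y.
Proof.
move=> y0; rewrite /expR -(big_mkord xpredT (fun i => y ^+ i / i`!%:R)).
apply: (nondecreasing_cvgn_le _ (is_cvg_series_exp_coeff y)).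
by apply: nondecreasing_series => i _ _; exact: exp_coeff_ge0.
Qed.

Lemma expR_cvg (y : R) : \sum_(i < n) y ^+ i / i`!%:R @[n --> \oo] --> expR y.
Proof.
under eq_fun do rewrite -(big_mkord xpredT (fun i => y ^+ i / i`!%:R)).
exact: is_cvg_series_exp_coeff.
Qed.

(** Expand e^(s(x)) and integrate termwise: the partial sums are polynomials, so
    that their integrals vanish, and as |s| is small with respect to a x^2 they
    are all dominated by means of a wider Gaussian. *)
Lemma moments_mul_exp h b a s C : 0 < b -> 2 * b <= a -> rintegrable mu h ->
  (forall x, `|s.[x]| <= b * x ^+ 2 + C) ->
  (forall p, \int[mu]_x (h x * (p.[x] * gauss a x)) = 0) ->
  forall p, \int[mu]_x (h x * (p.[x] * (gauss a x * expR s.[x]))) = 0.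
Proof.
move=> b0 ba hi hs h0 p.
pose q n := p * \sum_(i < n) i`!%:R^-1 *: s ^+ i.
have qE n x : (q n).[x] = p.[x] * \sum_(i < n) s.[x] ^+ i / i`!%:R.
  rewrite hornerM horner_sum; congr (_ * _); apply: eq_bigr => i _.
  by rewrite hornerZ horner_exp mulrC.
have a0 : 0 < a by lra.
have [_ cv] : rintegrable mu (fun x => h x * (p.[x] * (gauss a x * expR s.[x]))) /\
    \int[mu]_x (h x * ((q n).[x] * gauss a x)) @[n --> \oo] -->
    \int[mu]_x (h x * (p.[x] * (gauss a x * expR s.[x]))).
  apply: (@dominated_cvg_Rint _ _ _ mu _ _
    (fun x => expR C * `|h x * (p.[x] * gauss b x)|)).
  - by move=> n; apply: rintegrable_measurable; exact: rintegrable_mul_poly_gauss.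
  - by apply/rintegrableZ/rintegrable_norm; exact: rintegrable_mul_poly_gauss.
  - move=> n x; rewrite qE.
    set S := \sum_(i < n) _.
    have hS : `|S| <= expR (b * x ^+ 2 + C).
      rewrite (le_trans (ler_norm_sum _ _ _))//.
      apply: (le_trans _ (_ : expR `|s.[x]| <= _)); last by rewrite ler_expR.
      apply: le_trans (@expR_partial_sum _ n (normr_ge0 _)).
      apply: ler_sum => i _; rewrite normrM normrX ler_wpM2l ?exprn_ge0//.
      by rewrite ger0_norm// invr_ge0.
    rewrite !normrM -!mulrA [leRHS]mulrCA ler_wpM2l// [leRHS]mulrCA ler_wpM2l//.
    rewrite !(ger0_norm (gauss_ge0 _ _)).
    apply: (@le_trans _ _ (expR (b * x ^+ 2 + C) * gauss a x)).
      by rewrite ler_wpM2r// gauss_ge0.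
    rewrite /gauss -!expRD ler_expR; have := sqr_ge0 x; nra.
  - move=> x; under eq_fun do rewrite qE -mulrA.
    apply: cvgMl_tmp; apply: cvgMl_tmp; rewrite [gauss a x * _]mulrC.
    by apply: cvgMr_tmp; exact: expR_cvg.
move: cv; under eq_fun do rewrite h0.
by move/(cvg_lim _) => <-//; rewrite lim_cst.
Qed.

Section zero_moments.
Variables (h : R -> R) (b : R).
Hypotheses (b0 : 0 < b) (hi : rintegrable mu h).
Hypothesis h0 : forall p, \int[mu]_x (h x * (p.[x] * gauss (2 * b) x)) = 0.

(** Iterate with s(x) = - b x^2. The exponent grows in small steps, because the
    absolute value of s may not exceed half of the current exponent. *)
Lemma moments_gauss k p :
  \int[mu]_x (h x * (p.[x] * gauss (k.+2%:R * b) x)) = 0.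
Proof.
elim: k p => [|k ih] p; first exact: h0.
have kb : 2 * b <= k.+2%:R * b by rewrite ler_wpM2r ?(ltW b0)// ler_nat.
have hs x : `|((- b) *: 'X^2 : {poly R}).[x]| <= b * x ^+ 2 + 0.
  by rewrite hornerZ hornerXn mulNr normrN addr0 ger0_norm// mulr_ge0 ?sqr_ge0// ltW.
rewrite -[RHS](moments_mul_exp b0 kb hi hs ih p).
apply: eq_Rintegral => x _; congr (_ * (_ * _)).
by rewrite hornerZ hornerXn /gauss -expRD -[k.+3%:R]natr1; congr expR; ring.
Qed.

(** With s(x) = 2 a c x, completing the square turns the weight e^(-a x^2) into
    a Gaussian centred at c. *)
Lemma moments_gauss_shift k c :
  \int[mu]_x (h x * gauss (k.+2%:R * b) (x - c)) = 0.
Proof.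
set a := k.+2%:R * b; pose t := 2 * a * c.
have kb : 2 * b <= a by rewrite ler_wpM2r ?(ltW b0)// ler_nat.
have hs x : `|(t *: 'X : {poly R}).[x]| <= b * x ^+ 2 + t ^+ 2 / b.
  rewrite hornerZ hornerX.
  have h1 : 0 <= (b * x - t) ^+ 2 / b by rewrite divr_ge0 ?sqr_ge0// ltW.
  have h2 : 0 <= (b * x + t) ^+ 2 / b by rewrite divr_ge0 ?sqr_ge0// ltW.
  have e1 : (b * x - t) ^+ 2 / b = b * x ^+ 2 + t ^+ 2 / b - 2 * (t * x).
    by field; rewrite gt_eqF.
  have e2 : (b * x + t) ^+ 2 / b = b * x ^+ 2 + t ^+ 2 / b + 2 * (t * x).
    by field; rewrite gt_eqF.
  have h3 : 0 <= b * x ^+ 2 by rewrite mulr_ge0 ?sqr_ge0// ltW.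
  have h4 : 0 <= t ^+ 2 / b by rewrite divr_ge0 ?sqr_ge0// ltW.
  rewrite ler_norml; apply/andP; split; lra.
have a0 : 0 < a by rewrite mulr_gt0.
have := moments_mul_exp b0 kb hi hs (moments_gauss k) 1.
move/(congr1 ( *%R (gauss a c))); rewrite mulr0 => <-.
have gE x : gauss a (x - c) = gauss a c * (gauss a x * expR (t *: 'X : {poly R}).[x]).
  by rewrite hornerZ hornerX /gauss -!expRD /t; congr expR; ring.
have ci : rintegrable mu (fun x => h x * gauss a (x - c)).
  apply: (@rintegrable_bounded_mul _ _ 1) => //.
    apply: (@measurableT_comp _ _ _ _ _ _ (gauss a)); first exact: measurable_gauss.
    exact: measurable_funB.
  by move=> x; rewrite ger0_norm ?gauss_ge0// gauss_le1// ltW.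
rewrite -RintZ.
  by apply: eq_Rintegral => x _; rewrite gE hornerC mul1r; ring.
have -> : (fun x => h x * ((1 : {poly R}).[x] * (gauss a x * expR (t *: 'X : {poly R}).[x])))
  = (fun x => (gauss a c)^-1 * (h x * gauss a (x - c))).
  apply/funext => x; rewrite gE hornerC mul1r.
  by field; rewrite gt_eqF// expR_gt0.
exact: rintegrableZ.
Qed.

End zero_moments.
End gaussian_moments.

Section steep_polynomials.
Context (R : realType).
Implicit Types (u y : R).

Lemma bernoulli_inequality y n : 0 <= y <= 1 -> 1 - n%:R * y <= (1 - y) ^+ n.
Proof.
move=> /andP[y0 y1]; elim: n => [|n ih]; first by rewrite mul0r subr0.
rewrite exprS; apply: (@le_trans _ _ ((1 - y) * (1 - n%:R * y))); last first.
  by rewrite ler_wpM2l// subr_ge0.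
have := ler0n R n; rewrite -natr1; nra.
Qed.

Lemma bernoulli_inequality_inv y n : 0 <= y <= 1 -> (1 - y) ^+ n * (1 + n%:R * y) <= 1.
Proof.
move=> /andP[y0 y1]; elim: n => [|n ih]; first by rewrite mul0r addr0 mulr1.
apply: le_trans ih; rewrite exprSr -mulrA ler_wpM2l// ?exprn_ge0 ?subr_ge0//.
by have := ler0n R n; rewrite -natr1; nra.
Qed.

(** These polynomials approximate on [0, 1] the step at 1/2, while staying in
    [0, 1] and vanishing at 0. *)
Definition steep_poly n : {poly R} := 1 - (1 - 'X^(n.+1)) ^+ (2 ^ n.+1).

Lemma steep_polyE n u : (steep_poly n).[u] = 1 - (1 - u ^+ n.+1) ^+ (2 ^ n.+1).
Proof. by rewrite /steep_poly hornerD hornerN horner_exp hornerD hornerN hornerXn !hornerC. Qed.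

Lemma steep_poly_coef0 n : (steep_poly n)`_0 = 0.
Proof. by rewrite -horner_coef0 steep_polyE expr0n subr0 expr1n subrr. Qed.

Lemma steep_poly_bound n u : 0 <= u <= 1 -> 0 <= (steep_poly n).[u] <= 1.
Proof.
move=> /andP[u0 u1]; rewrite steep_polyE.
have v0 : 0 <= 1 - u ^+ n.+1 by rewrite subr_ge0 exprn_ile1.
have v1 : 1 - u ^+ n.+1 <= 1 by rewrite gerBl exprn_ge0.
by rewrite subr_ge0 exprn_ile1//= gerBl exprn_ge0.
Qed.

Lemma cvg_exprS (z : R) : `|z| < 1 -> z ^+ n.+1 @[n --> \oo] --> (0 : R).
Proof. by move=> z1; rewrite (cvg_shiftS (fun n => z ^+ n)); exact: cvg_expr. Qed.

Lemma steep_poly_cvg0 u : 0 <= u -> u < 2^-1 ->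
  (steep_poly n).[u] @[n --> \oo] --> (0 : R).
Proof.
move=> u0 u2; have u1 : u <= 1 by lra.
apply: (@cvg0_dominated _ _ (fun n => (2 * u) ^+ n.+1)) => [n|].
  have /andP[p0 _] := @steep_poly_bound n u (introT andP (conj u0 u1)).
  rewrite ger0_norm// steep_polyE lerBlDr -lerBlDl exprMn -natrX.
  by rewrite bernoulli_inequality// exprn_ge0//= exprn_ile1.
by apply: cvg_exprS; rewrite ger0_norm ?mulr_ge0//; lra.
Qed.

Lemma steep_poly_cvg1 u : 2^-1 < u -> u <= 1 ->
  (steep_poly n).[u] @[n --> \oo] --> (1 : R).
Proof.
move=> u2 u1; have u0 : 0 <= u by lra.
rewrite -[X in _ --> X](subr0 1); under eq_fun do rewrite steep_polyE.
apply: cvgB; first exact: cvg_cst.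
have z0 : 0 < 2 * u by lra.
apply: (@cvg0_dominated _ _ (fun n => (2 * u)^-1 ^+ n.+1)) => [n|].
  have v0 : 0 <= 1 - u ^+ n.+1 by rewrite subr_ge0 exprn_ile1.
  rewrite ger0_norm ?exprn_ge0// exprVn -[leRHS]mul1r ler_pdivlMr ?exprn_gt0//.
  apply: le_trans (@bernoulli_inequality_inv (u ^+ n.+1) (2 ^ n.+1) _); last first.
    by rewrite exprn_ge0//= exprn_ile1.
  by rewrite ler_wpM2l ?exprn_ge0// exprMn -natrX lerDr.
apply: cvg_exprS; rewrite ger0_norm ?invr_ge0 ?ltW// invf_lt1//; lra.
Qed.

End steep_polynomials.

Section gaussian_completeness.
Context (R : realType).
Local Notation mu := (@lebesgue_measure R).
Implicit Types (p q s : {poly R}) (a b c x : R).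

(** For a > 0, the Gaussian e^(-a x^2) exceeds 1/2 exactly when |x| is less than
    this. *)
Definition gauss_radius a := Num.sqrt (ln 2 / a).

Lemma gauss_radius_gt0 a : 0 < a -> 0 < gauss_radius a.
Proof. by move=> a0; rewrite sqrtr_gt0 divr_gt0// ln_gt0// ltr1n. Qed.

Lemma gauss_radius_sqr a : 0 < a -> a * gauss_radius a ^+ 2 = ln 2.
Proof.
move=> a0; rewrite sqr_sqrtr; first by rewrite mulrC divfK// gt_eqF.
by rewrite divr_ge0// ?(ltW a0)// ln_ge0// ler1n.
Qed.

Let expRNln2 : expR (- ln 2) = 2^-1 :> R.
Proof. by rewrite expRN lnK// posrE. Qed.

Lemma gauss_gt_half a x : 0 < a -> `|x| < gauss_radius a -> 2^-1 < gauss a x.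
Proof.
move=> a0 xr; rewrite -expRNln2 ltr_expR ltrN2 -(gauss_radius_sqr a0).
by rewrite ltr_pM2l// -real_normK ?num_real// ltr_pXn2r ?nnegrE ?sqrtr_ge0.
Qed.

Lemma gauss_lt_half a x : 0 < a -> gauss_radius a < `|x| -> gauss a x < 2^-1.
Proof.
move=> a0 xr; rewrite -expRNln2 ltr_expR ltrN2 -(gauss_radius_sqr a0).
by rewrite ltr_pM2l// -[ltRHS]real_normK ?num_real// ltr_pXn2r ?nnegrE ?sqrtr_ge0.
Qed.

Lemma gauss_radius_cvg0 b : 0 < b ->
  gauss_radius (n.+2%:R * b) @[n --> \oo] --> (0 : R).
Proof.
move=> b0; rewrite -[X in _ --> X](sqrtr0 R).
have -> : (fun n => gauss_radius (n.+2%:R * b)) =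
          Num.sqrt \o (fun n => ln 2 / b * harmonic n.+1).
  apply/funext => n; rewrite /gauss_radius /harmonic /=; congr Num.sqrt.
  by rewrite [n.+2%:R * b]mulrC invfM mulrA.
apply: continuous_cvg; first exact: sqrt_continuous.
rewrite -[X in _ --> X](mulr0 (ln 2 / b)); apply: cvgMl_tmp.
by rewrite (cvg_shiftS (@harmonic R : nat -> R^o)); exact: cvg_harmonic.
Qed.

Section zero_moments.
Variables (h : R -> R) (b : R).
Hypotheses (b0 : 0 < b) (hi : rintegrable mu h).
Hypothesis h0 : forall p, \int[mu]_x (h x * (p.[x] * gauss (2 * b) x)) = 0.

(** Powers of a Gaussian are Gaussians with the same centre, and only the power
    0 has to be excluded. *)
Lemma moments_poly_gauss k c q : q`_0 = 0 ->
  \int[mu]_x (h x * q.[gauss (k.+2%:R * b) (x - c)]) = 0.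
Proof.
move=> q0.
have a0 n : 0 < n.+2%:R * b by rewrite mulr_gt0.
have mg n : measurable_fun setT (fun x => gauss (n.+2%:R * b) (x - c)).
  apply: (@measurableT_comp _ _ _ _ _ _ (gauss _)); first exact: measurable_gauss.
  exact: measurable_funB.
have ti i : rintegrable mu (fun x => q`_i * (h x * gauss (k.+2%:R * b) (x - c) ^+ i)).
  apply/rintegrableZ/(@rintegrable_bounded_mul _ _ _ 1) => //; first exact: measurable_funX.
  by move=> x; rewrite normrX exprn_ile1// ger0_norm ?gauss_ge0// gauss_le1// ltW.
transitivity (\int[mu]_x \sum_(i <- index_iota 0 (size q))
   (q`_i * (h x * gauss (k.+2%:R * b) (x - c) ^+ i))).
  apply: eq_Rintegral => x _; rewrite horner_coef mulr_sumr big_mkord.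
  by apply: eq_bigr => i _; ring.
rewrite Rint_sum// big1// => i _; case: i => [|i].
  by under eq_Rintegral do rewrite q0 mul0r; rewrite Rint0.
pose m := (k.+2 * i.+1).-2.
have mE : m.+2 = (k.+2 * i.+1)%N by rewrite /m 2!mulSn addSn addnS.
have e x : h x * gauss (k.+2%:R * b) (x - c) ^+ i.+1 = h x * gauss (m.+2%:R * b) (x - c).
  by rewrite gaussX mE natrM mulrAC.
under eq_Rintegral do rewrite e.
rewrite RintZ ?(moments_gauss_shift b0 hi h0) ?mulr0//.
apply: (@rintegrable_bounded_mul _ _ _ 1) => // x.
by rewrite ger0_norm ?gauss_ge0// gauss_le1// ltW.
Qed.

(** Composed with a Gaussian centred at c, the steep polynomials tend to the
    indicator of the ball, except on its boundary; being bounded by 1, they let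
    |h| dominate. *)
Lemma moments_ball k c :
  \int[mu]_(x in ball c (gauss_radius (k.+2%:R * b))) h x = 0.
Proof.
set a := k.+2%:R * b; set r := gauss_radius a.
have a0 : 0 < a by rewrite mulr_gt0.
have mB : measurable (ball c r : set R) by exact: measurable_ball.
have u01 x : 0 <= gauss a (x - c) <= 1 by rewrite gauss_ge0 gauss_le1// ltW.
have mg : measurable_fun setT (fun x => gauss a (x - c)).
  apply: (@measurableT_comp _ _ _ _ _ _ (gauss _)); first exact: measurable_gauss.
  exact: measurable_funB.
have mq q : measurable_fun setT (fun x => q.[gauss a (x - c)]).
  by apply: (@measurableT_comp _ _ _ _ _ _ (horner q)) => //; exact: measurable_horner.
have mh := rintegrable_measurable hi.
have [_ cv] : rintegrable mu (fun x => h x * \1_(ball c r) x) /\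
    \int[mu]_x (h x * (steep_poly R n).[gauss a (x - c)]) @[n --> \oo] -->
    \int[mu]_x (h x * \1_(ball c r) x).
  apply: (@dominated_cvg_Rint_ae _ _ _ mu _ _ (fun x => `|h x|)).
  - by move=> n; apply: measurable_funM; [exact: mh|exact: mq].
  - by apply: measurable_funM => //; exact: measurable_indic.
  - exact: rintegrable_norm.
  - move=> n x; rewrite normrM ler_piMr//.
    by have /andP[p0 p1] := steep_poly_bound n (u01 x); rewrite ger0_norm.
  - exists ([set c - r] `|` [set c + r]); split.
    + exact: measurableU.
    + by apply/eqP; rewrite -measure_le0 (le_trans (measureU2 _ _ _))//= !lebesgue_measure_set1 adde0.
    + move=> x /= nx; apply/or_asboolP; rewrite -(negbK (_ || _)) negb_or.
      apply/negP => /andP[/asboolP x1 /asboolP x2]; apply: nx.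
      apply: cvgMl_tmp; rewrite indicE.
      have [xr|xr|xr] := ltgtP `|x - c| r.
      * rewrite mem_set; last by rewrite /ball /= distrC.
        apply: steep_poly_cvg1; first exact: gauss_gt_half.
        by case/andP: (u01 x).
      * rewrite memNset; last by rewrite /ball /= distrC; apply/negP; rewrite -leNgt ltW.
        apply: steep_poly_cvg0; first by case/andP: (u01 x).
        exact: gauss_lt_half.
      * exfalso; case: (lerP 0 (x - c)) xr => xc.
          by move=> e; apply: x2; rewrite /= -e ger0_norm// addrC subrK.
        by move=> e; apply: x1; rewrite /= -e ltr0_norm// opprK addrC subrK.
rewrite Rintegral_mkcond patch_indic.
move: cv; under eq_fun do rewrite moments_poly_gauss ?steep_poly_coef0//.
by move/(cvg_lim _) => <-//; rewrite lim_cst.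
Qed.

(** The averages of h over balls shrinking to any given point vanish, and
    Lebesgue's differentiation theorem applies. *)
Lemma gaussian_moments_eq0 : h = (fun=> 0) %[ae mu].
Proof.
pose r n := gauss_radius (n.+2%:R * b).
have r0 n : 0 < r n by rewrite gauss_radius_gt0// mulr_gt0.
pose E x n : set R := ball x (r n).
have hE x : nicely_shrinking x (E x).
  split; first by move=> n; exact: measurable_ball.
  exists (1, (fun n => PosNum (r0 n))); split => //=.
    exact: gauss_radius_cvg0.
    by move=> n.
  by move=> n; rewrite mul1e.
have hl : locally_integrable setT h by apply: open_integrable_locally => //; exact: openT.
have := lebesgue_differentiation hl; apply: (@filterS _ _ (ae_filter_ringOfSetsType mu)) => x hx _.
have := nice_lebesgue_differentiation hE hl hx.
under eq_fun.
  move=> n.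
  have -> : (\int[mu]_(y in E x n) (h y)%:E = 0)%E.
    rewrite -[RHS]/(0%:E) -(moments_ball n x) /Rintegral fineK//.
    apply: integrable_fin_num => //; first exact: measurable_ball.
    by apply: integrableS hi => //; exact: measurable_ball.
  rewrite mule0; over.
by move/(cvg_lim _) => h1; apply/EFin_inj; rewrite -h1// lim_cst.
Qed.

End zero_moments.
End gaussian_completeness.

(** * Orthonormal sequences: Bessel's inequality and the Riesz-Fischer theorem *)

Section orthonormal_system.
Context d (T : measurableType d) (R : realType).
Variable mu : {measure set T -> \bar R}.
Variable e : nat -> T -> R.
Hypothesis e2 : forall n, sqint mu (e n).
Hypothesis eON : forall m n, \int[mu]_x (e m x * e n x) = (m == n)%:R.
Implicit Types (f g : T -> R) (c : nat -> R).

Definition coef f k := \int[mu]_x (e k x * f x).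

Lemma rintegrable_coef k f : sqint mu f -> rintegrable mu (fun x => e k x * f x).
Proof. exact: rintegrable_sqintM. Qed.

Lemma coefB f g k : sqint mu f -> sqint mu g ->
  coef (fun x => f x - g x) k = coef f k - coef g k.
Proof.
move=> f2 g2; rewrite /coef -RintB; [|exact: rintegrable_coef..].
by apply: eq_Rintegral => x _; rewrite mulrBr.
Qed.

Definition partial_sum c m n x := \sum_(m <= i < n) c i * e i x.

Lemma sqint_partial_sum c m n : sqint mu (partial_sum c m n).
Proof. by apply: sqint_sum => i; exact: sqintZ. Qed.

Lemma Rint_partial_sum c m n f : sqint mu f ->
  \int[mu]_x (partial_sum c m n x * f x) = \sum_(m <= i < n) c i * coef f i.
Proof.
move=> f2; rewrite -(eq_bigr _ (fun i _ => RintZ (c i) (rintegrable_coef i f2))) -Rint_sum.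
  by apply: eq_Rintegral => x _; rewrite mulr_suml; apply: eq_bigr => i _; rewrite mulrA.
by move=> i; exact/rintegrableZ/rintegrable_coef.
Qed.

Lemma coef_partial_sum c m n k : (m <= k < n)%N -> coef (partial_sum c m n) k = c k.
Proof.
move=> mkn; rewrite /coef; under eq_Rintegral do rewrite mulrC.
rewrite Rint_partial_sum// (bigD1_seq k) ?mem_index_iota ?iota_uniq//=.
rewrite [coef _ _]eON eqxx mulr1 big1 ?addr0// => i ik.
by rewrite [coef _ _]eON (negbTE ik) mulr0.
Qed.

Lemma Rint_partial_sum_sqr c m n :
  \int[mu]_x (partial_sum c m n x ^+ 2) = \sum_(m <= i < n) c i ^+ 2.
Proof.
under eq_Rintegral do rewrite expr2; rewrite Rint_partial_sum; last exact: sqint_partial_sum.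
by apply: eq_big_nat => i imn; rewrite coef_partial_sum.
Qed.

Lemma Rint_sqrB f g : sqint mu f -> sqint mu g -> \int[mu]_x ((f x - g x) ^+ 2) =
  \int[mu]_x (f x ^+ 2) - 2 * \int[mu]_x (g x * f x) + \int[mu]_x (g x ^+ 2).
Proof.
move=> f2 g2; have gf := rintegrable_sqintM g2 f2.
rewrite -RintZ// -RintB; [|by case: f2|exact: rintegrableZ].
rewrite -RintD; [|by apply: rintegrableB; [case: f2|exact: rintegrableZ]|by case: g2].
by apply: eq_Rintegral => x _; ring.
Qed.

Lemma bessel_identity f n : sqint mu f ->
  \int[mu]_x ((f x - partial_sum (coef f) 0 n x) ^+ 2) =
  \int[mu]_x (f x ^+ 2) - \sum_(0 <= i < n) coef f i ^+ 2.
Proof.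
move=> f2; rewrite Rint_sqrB//; last exact: sqint_partial_sum.
rewrite Rint_partial_sum// Rint_partial_sum_sqr.
by under eq_bigr do rewrite -expr2; ring.
Qed.

Lemma bessel f n : sqint mu f ->
  series (fun k => coef f k ^+ 2) n <= \int[mu]_x (f x ^+ 2).
Proof.
move=> f2; rewrite -subr_ge0 -bessel_identity//.
by apply: Rintegral_ge0 => x _; exact: sqr_ge0.
Qed.

Lemma series_sqr_nondecreasing c : nondecreasing_seq (series (fun k => c k ^+ 2)).
Proof. by apply: nondecreasing_series => i _ _; exact: sqr_ge0. Qed.

Lemma bessel_cvg f : sqint mu f -> cvgn (series (fun k => coef f k ^+ 2)).
Proof.
move=> f2; apply: nondecreasing_is_cvgn; first exact: series_sqr_nondecreasing.
by exists (\int[mu]_x (f x ^+ 2)) => _ [n _ <-]; exact: bessel.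
Qed.

(** The Cauchy-Schwarz inequality against a unit vector, as a case of Bessel's
    inequality. *)
Lemma coef_sqr_le f k : sqint mu f -> coef f k ^+ 2 <= \int[mu]_x (f x ^+ 2).
Proof.
move=> f2; apply: le_trans (bessel k.+1 f2).
by rewrite /series /= big_nat_recr//= lerDr sumr_ge0// => i _; exact: sqr_ge0.
Qed.

(** Fatou's lemma, in the form in which it bounds the norm of a limit. *)
Lemma fatou_bound (f_ : nat -> T -> R) f (C : R) :
  (forall n, sqint mu (f_ n)) -> (forall x, f_ n x @[n --> \oo] --> f x) ->
  (forall n, \int[mu]_x (f_ n x ^+ 2) <= C) ->
  sqint mu f /\ \int[mu]_x (f x ^+ 2) <= C.
Proof.
move=> f_2 cf fC.
have mf : measurable_fun setT f.
  by apply: (measurable_fun_cvg (h := f_)) => [n|x _]; [case: (f_2 n)|exact: cf].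
have h : (\int[mu]_x (f x ^+ 2)%:E <= C%:E)%E.
  have := @fatou _ _ _ mu setT measurableT (fun n x => (f_ n x ^+ 2)%:E) _ _.
  have -> : (\int[mu]_x limn_einf (fun n => (f_ n x ^+ 2)%:E) = \int[mu]_x (f x ^+ 2)%:E)%E.
    apply: eq_integral => x _.
    have cx : (f_ n x ^+ 2)%:E @[n --> \oo] --> (f x ^+ 2)%:E.
      apply: cvg_EFin; first exact: nearW.
      by rewrite expr2; under eq_fun do rewrite expr2; exact: cvgM.
    rewrite is_cvg_limn_einfE; first exact/cvg_lim.
    by apply/cvg_ex; eexists; exact: cx.
  move=> /(_ _ _)/le_trans; apply.
  - by move=> n; apply/measurable_EFinP/measurable_funX; case: (f_2 n).
  - by move=> n x _; rewrite lee_fin sqr_ge0.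
  rewrite limn_einf_lim; apply: lime_le; first exact: is_cvg_einfs.
  apply: nearW => n; apply: (@le_trans _ _ (\int[mu]_x (f_ n x ^+ 2)%:E)%E).
    by apply: ereal_inf_lbound; exists n => //=.
  by rewrite -Rint_EFin ?lee_fin//; case: (f_2 n).
have f2 : rintegrable mu (fun x => f x ^+ 2).
  apply: ge0_rintegrable; first exact: measurable_funX.
    by move=> x; exact: sqr_ge0.
  by rewrite (le_lt_trans h)// ltry.
by split; [split|rewrite -lee_fin Rint_EFin].
Qed.

Section riesz_fischer.
Variable c : nat -> R.
Hypothesis c2 : cvgn (series (fun k => c k ^+ 2)).
Let S2 := series (fun k => c k ^+ 2).
Let L : R := limn S2.

Let S2_le n : S2 n <= L.
Proof. exact: nondecreasing_cvgn_le (series_sqr_nondecreasing c) c2 n. Qed.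

Let tail_le m n : (m <= n)%N -> \int[mu]_x (partial_sum c m n x ^+ 2) <= L - S2 m.
Proof.
by move=> mn; rewrite Rint_partial_sum_sqr -sub_series_geq// lerD2r.
Qed.

(** Monotonicity lets the blocks between consecutive indices telescope. *)
Let sub_index : {n : nat -> nat | nondecreasing_seq n /\
  forall j, (j <= n j)%N /\ L - S2 (n j) <= 4^-1 ^+ j}.
Proof.
have h j : exists N, forall n, (N <= n)%N -> L - S2 n <= 4^-1 ^+ j.
  have e0 : 0 < 4^-1 ^+ j :> R by rewrite exprn_gt0.
  have [N _ hN] := @cvgr_dist_le _ R^o _ _ _ S2 L c2 _ e0.
  exists N => n Nn; apply: le_trans (hN n Nn); exact: ler_norm.
have /choice[N hN] := h.
exists (fun j => (\sum_(i < j.+1) N i + j)%N); split.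
  apply/nondecreasing_seqP => j.
  rewrite leEnat /= [X in (_ <= X + _)%N]big_ord_recr /=.
  by rewrite leq_add ?leqnSn// leq_addr.
move=> j; split; first by rewrite leq_addl.
by apply: hN; rewrite big_ord_recr /= -addnA addnCA leq_addr.
Qed.

Let nu := sval sub_index.
Let nu_nd i j : (i <= j)%N -> (nu i <= nu j)%N.
Proof. by move=> ij; have [+ _] := svalP sub_index => /(_ _ _ ij). Qed.
Let nu_ge j : (j <= nu j)%N.
Proof. by have [_ /(_ j)[]] := svalP sub_index. Qed.
Let nu_tail j : L - S2 (nu j) <= 4^-1 ^+ j.
Proof. by have [_ /(_ j)[]] := svalP sub_index. Qed.

Let delta j x := partial_sum c (nu j) (nu j.+1) x.

Let partial_sum_nuE j x : partial_sum c 0 (nu j) x =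
  partial_sum c 0 (nu 0) x + series (delta ^~ x) j.
Proof.
elim: j => [|j ih]; first by rewrite /series /= big_geq// addr0.
rewrite seriesSr addrA -ih /partial_sum /delta /partial_sum.
by rewrite -big_cat_nat//= nu_nd.
Qed.

(* The weights 2^j leave the integrals summable, and make pointwise
   summability of the squares imply that of the absolute values. *)
Let wsq j x := 2 ^+ j * delta j x ^+ 2.

Let wsq_ge0 j x : 0 <= wsq j x.
Proof. by rewrite mulr_ge0 ?sqr_ge0// exprn_ge0. Qed.

Let wsq_rint j : rintegrable mu (wsq j).
Proof. by apply: rintegrableZ; case: (sqint_partial_sum c (nu j) (nu j.+1)). Qed.

Let wsq_le j : \int[mu]_x wsq j x <= 2^-1 ^+ j.
Proof.
rewrite RintZ; last by case: (sqint_partial_sum c (nu j) (nu j.+1)).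
have h := le_trans (tail_le (nu_nd (leqnSn j))) (nu_tail j).
have p0 : 0 <= 2 ^+ j :> R by rewrite exprn_ge0.
apply: (le_trans (ler_wpM2l p0 h)); rewrite -exprMn.
by have -> : 2 * 4^-1 = 2^-1 :> R by field.
Qed.

Let ae_summable : {ae mu, forall x, (\sum_(j <oo) (wsq j x)%:E < +oo)%E}.
Proof.
have mw j : measurable_fun setT (fun x => (wsq j x)%:E).
  by apply/measurable_EFinP; exact: rintegrable_measurable (wsq_rint j).
have ge0 x : (0 <= \sum_(j <oo) (wsq j x)%:E)%E.
  by apply: nneseries_ge0 => j _ _; rewrite lee_fin.
have wi : mu.-integrable setT (fun x => \sum_(j <oo) (wsq j x)%:E)%E.
  apply/integrableP; split.
    by apply: ge0_emeasurable_sum => // j x _ _; rewrite lee_fin.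
  under eq_integral do rewrite gee0_abs//.
  rewrite integral_nneseries//; last by move=> j x _; rewrite lee_fin.
  apply: (@le_lt_trans _ _ (\sum_(j <oo) (2^-1 ^+ j)%:E)%E).
    apply: lee_nneseries => [j _ _|j _]; first by apply: integral_ge0 => x _; rewrite lee_fin.
    by rewrite -Rint_EFin// lee_fin.
  by rewrite nneseries_EFin ?ltry//; exact: cvg_series_half.
have := integrable_ae measurableT wi; apply: filterS => x /(_ I).
by rewrite ge0_fin_numE.
Qed.

Let cvg_of_summable x : (\sum_(j <oo) (wsq j x)%:E < +oo)%E ->
  cvgn (fun j => partial_sum c 0 (nu j) x).
Proof.
move=> h; have cw := nnseries_is_cvg (wsq_ge0 ^~ x) h.
have cd : cvgn (series (delta ^~ x)).
  apply: normed_cvg.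
  apply: (@series_le_cvg _ _ ((fun j => 2^-1 ^+ j) + (fun j => wsq j x))) => [j|j|j|].
  - exact: normr_ge0.
  - by apply: addr_ge0 => //; rewrite exprn_ge0// invr_ge0.
  - rewrite [leRHS]/(_ + _) /wsq -[X in _ <= _ + _ * X]real_normK ?num_real// exprVn.
    by apply: le_invD_mul_sqr; rewrite exprn_gt0.
  - by apply: is_cvg_seriesD => //; exact: cvg_series_half.
under eq_fun do rewrite partial_sum_nuE.
by apply: is_cvgD => //; exact: is_cvg_cst.
Qed.

(** The subsequence of partial sums with geometric tails converges almost
    everywhere, and by Fatou's lemma its limit g is as close to the n-th partial
    sum as the tail of the series from n on. *)
Theorem riesz_fischer : exists g, [/\ sqint mu g, forall k, coef g k = c k &
  \int[mu]_x (g x ^+ 2) = L].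
Proof.
have [N [mN N0 hN]] := ae_summable.
have mI : measurable_fun setT (\1_(~` N) : T -> R).
  by apply: measurable_indic; exact: measurableC.
(* Cutting off on the null set N makes the sequence converge everywhere, so that
   the limit is measurable. *)
pose P m n x := partial_sum c m n x * \1_(~` N) x.
have P2 m n : sqint mu (P m n) /\
  \int[mu]_x (P m n x ^+ 2) <= \int[mu]_x (partial_sum c m n x ^+ 2).
  have [mS S2'] := sqint_partial_sum c m n.
  have mP : measurable_fun setT (P m n) by exact: measurable_funM.
  have PS x : P m n x ^+ 2 <= partial_sum c m n x ^+ 2.
    by rewrite /P indicE; case: (_ \in _); rewrite ?mulr1// mulr0 expr0n sqr_ge0.
  have iP : rintegrable mu (fun x => P m n x ^+ 2).
    apply: (rintegrable_dominated _ S2'); first exact: measurable_funX.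
    by move=> x; rewrite ger0_norm// sqr_ge0.
  by split; [split|exact: le_Rint].
have cP x : cvgn (fun j => P 0 (nu j) x).
  rewrite /P indicE; have [xN|xN] := boolP (x \in ~` N).
    apply: is_cvgMr_tmp; apply: cvg_of_summable.
    apply: contrapT => h; move: xN; rewrite inE; apply; exact: hN.
  under eq_fun do rewrite mulr0; exact: is_cvg_cst.
pose g x := limn (fun j => P 0 (nu j) x).
have gP m : sqint mu (fun x => g x - P 0 m x) /\
            \int[mu]_x ((g x - P 0 m x) ^+ 2) <= L - S2 m.
  have PB j x : (m <= nu j)%N -> P 0 (nu j) x - P 0 m x = P m (nu j) x.
    move=> mj; rewrite /P -mulrBl; congr (_ * _).
    by rewrite /partial_sum (big_cat_nat _ (n := m))//= addrAC subrr add0r.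
  have mj j : (m <= nu (m + j))%N by rewrite (leq_trans (leq_addr j m)).
  apply: (@fatou_bound (fun j => P m (nu (m + j)))).
  - by move=> j; case: (P2 m (nu (m + j))).
  - move=> x; under eq_fun do rewrite -PB//.
    apply: cvgB; last exact: cvg_cst.
    have -> : (fun j => P 0 (nu (m + j)) x) =
              [sequence (fun j => P 0 (nu j) x) (j + m)%N]_j.
      by apply/funext => j; rewrite /= addnC.
    by rewrite (cvg_shiftn m (fun j => P 0 (nu j) x)); exact: cP.
  - by move=> j; case: (P2 m (nu (m + j))) => _ /le_trans; apply; exact: tail_le.
have g2 : sqint mu g.
  rewrite (_ : g = fun x => (g x - P 0 0 x) + P 0 0 x).
    by apply: sqintD; [case: (gP 0)|case: (P2 0 0)].
  by apply/funext => x; rewrite subrK.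
have aeP m n : P m n = partial_sum c m n %[ae mu].
  exists N; split => // x /= h; apply: contrapT => xN; apply: h => _.
  by rewrite /P indicE mem_set ?mulr1.
have gS m : \int[mu]_x ((g x - partial_sum c 0 m x) ^+ 2) <= L - S2 m.
  have [_ h] := gP m; apply: le_trans h; rewrite le_eqVlt; apply/orP; left; apply/eqP.
  apply: Rint_ae_eq.
  - by apply/measurable_funX/measurable_funB; [case: g2|case: (sqint_partial_sum c 0 m)].
  - by apply/measurable_funX/measurable_funB; [case: g2|case: (P2 0 m) => -[]].
  - by apply: filterS (aeP 0 m) => x + _ => /(_ I) ->.
have cL : L - S2 n @[n --> \oo] --> (0 : R).
  rewrite -[X in _ --> X](subrr L); apply: cvgB; first exact: cvg_cst.
  exact: c2.
have gc k : coef g k = c k.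
  apply/eqP; rewrite -subr_eq0 -sqrf_eq0 eq_le sqr_ge0 andbT.
  have h n : (k < n)%N -> (coef g k - c k) ^+ 2 <= L - S2 n.
    move=> kn; apply: le_trans (gS n).
    rewrite -(@coef_partial_sum c 0 n k)// -coefB//; last exact: sqint_partial_sum.
    by apply: coef_sqr_le; apply: sqintB => //; exact: sqint_partial_sum.
  rewrite -(cvg_lim _ cL)//; apply: limr_ge; first by apply/cvg_ex; exists 0.
  by exists k.+1 => // n /= kn; exact: h.
exists g; split=> //; apply/eqP; rewrite eq_le; apply/andP; split.
  have := gS 0; under eq_Rintegral do rewrite /partial_sum big_geq// subr0.
  by rewrite /S2 /series /= big_geq// subr0.
apply: limr_le => //; apply: nearW => n.
by apply: le_trans (bessel n g2); rewrite /series /=; under [leRHS]eq_bigr do rewrite gc.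
Qed.
End riesz_fischer.

End orthonormal_system.

(** * The Hermite functions form a basis *)

Section hermite_expansion.
Context (R : realType).
Local Notation mu := (@lebesgue_measure R).
Implicit Types f : R -> R.
Local Notation eta := (@hermite_fun R).

Lemma sqint_hermite n : sqint mu (eta n).
Proof.
split; first exact: measurable_hermite_fun.
by under eq_fun do rewrite expr2; exact: rintegrable_hermite_fun_prod.
Qed.

Lemma sqint_poly_gauss (p : {poly R}) a : 0 < a -> sqint mu (fun x => p.[x] * gauss a x).
Proof.
move=> a0; split; first exact: measurable_poly_gauss.
have -> : (fun x => (p.[x] * gauss a x) ^+ 2) = (fun x => (p ^+ 2).[x] * gauss (a * 2%:R) x).
  by apply/funext => x; rewrite exprMn gaussX horner_exp.
by apply: rintegrable_poly_gauss; rewrite mulr_gt0.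
Qed.

(** Since the Hermite polynomials span all polynomials, the product of f with a
    Gaussian is an integrable function with vanishing Gaussian moments. *)
Lemma hermite_complete f : sqint mu f -> (forall k, coef mu eta f k = 0) ->
  f = (fun=> 0) %[ae mu].
Proof.
move=> f2 cf0.
have q0 : 0 < 4^-1 :> R by [].
have fi p a : 0 < a -> rintegrable mu (fun x => f x * (p.[x] * gauss a x)).
  by move=> a0; apply: rintegrable_sqintM => //; exact: sqint_poly_gauss.
have f0 p : \int[mu]_x (f x * (p.[x] * gauss 2^-1 x)) = 0.
  apply: (hermite_poly_span (P := fun p => \int[mu]_x (f x * (p.[x] * gauss 2^-1 x)) = 0)).
  - move=> {}p q hp hq; rewrite -[RHS]addr0 -{1}hp -hq -RintD; [|exact: fi..].
    by apply: eq_Rintegral => x _; rewrite hornerD; ring.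
  - move=> c {}p hp; rewrite -[RHS](mulr0 c) -hp -RintZ; last exact: fi.
    by apply: eq_Rintegral => x _; rewrite hornerZ; ring.
  - move=> n; rewrite -[RHS](mulr0 (hermite_norm R n)) -(cf0 n) -RintZ.
      apply: eq_Rintegral => x _; rewrite hermite_funE !mulrA mulfV; first by ring.
      by rewrite gt_eqF ?hermite_norm_gt0.
    by apply: rintegrable_sqintM => //; exact: sqint_hermite.
(* The exponent 1/2 is shared between h and the weight. *)
pose h x := f x * gauss 4^-1 x.
have hi : rintegrable mu h.
  have := fi 1 _ q0; rewrite /rintegrable.
  by have -> : (fun x => f x * ((1 : {poly R}).[x] * gauss 4^-1 x)) = h
    by apply/funext => x; rewrite hornerC mul1r.
have e8 : 0 < 8^-1 :> R by [].
have h0 p : \int[mu]_x (h x * (p.[x] * gauss (2 * 8^-1) x)) = 0.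
  rewrite -[RHS](f0 p); apply: eq_Rintegral => x _.
  have -> : 2^-1 = 4^-1 + 2 * 8^-1 :> R by field.
  by rewrite gaussD /h; ring.
have := gaussian_moments_eq0 e8 hi h0.
apply: (@filterS _ _ (ae_filter_ringOfSetsType mu)) => x + _ => /(_ I) /eqP.
by rewrite mulf_eq0 [gauss _ _ == 0]gt_eqF ?expR_gt0// orbF => /eqP.
Qed.

Lemma hermite_riesz_fischer (c : nat -> R) : cvgn (series (fun k => c k ^+ 2)) ->
  exists2 g, sqint mu g & forall k, coef mu eta g k = c k.
Proof.
by move=> /(riesz_fischer sqint_hermite (@hermite_orthonormal R))[g [g2 gc _]]; exists g.
Qed.

(** Parseval's identity: the function that Riesz-Fischer attaches to the
    coefficients of f is f itself, by completeness. *)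
Lemma hermite_parseval f : sqint mu f ->
  series (fun k => coef mu eta f k ^+ 2) @ \oo --> \int[mu]_x (f x ^+ 2).
Proof.
move=> f2; have cc := bessel_cvg sqint_hermite (@hermite_orthonormal R) f2.
have [g [g2 gc gL]] := riesz_fischer sqint_hermite (@hermite_orthonormal R) cc.
have fg0 : (fun x => f x - g x) = (fun=> 0) %[ae mu].
  apply: hermite_complete; first exact: sqintB.
  by move=> k; rewrite (coefB sqint_hermite)// gc subrr.
rewrite (_ : \int[mu]_x (f x ^+ 2) = \int[mu]_x (g x ^+ 2)); first by rewrite gL.
apply: Rint_ae_eq.
- by apply: measurable_funX; case: f2.
- by apply: measurable_funX; case: g2.
- apply: (@filterS _ _ (ae_filter_ringOfSetsType mu)) fg0 => x + _ => /(_ I) /eqP.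
  by rewrite subr_eq0 => /eqP ->.
Qed.

End hermite_expansion.

(** * Uniqueness of power series *)

Section power_series.
Context (R : realType).
Implicit Types c : nat -> R.

(** For r up to 1/2 the terms after the first add up to at most 2 M r,
    whatever their number. *)
Lemma power_series_coef0 c M : (forall k, `|c k| <= M) ->
  (forall r, 0 < r -> r <= 2^-1 ->
     series (fun k => r ^+ k * c k) @ \oo --> (0 : R)) -> c 0%N = 0.
Proof.
move=> cM cr; have M0 : 0 <= M by rewrite (le_trans _ (cM 0%N)).
have key r : 0 < r -> r <= 2^-1 -> `|c 0%N| <= 2 * M * r.
  move=> r0 r2.
  have h n : `|c 0%N| <= 2 * M * r + `|series (fun k => r ^+ k * c k) n.+1|.
    have -> : c 0%N = series (fun k => r ^+ k * c k) n.+1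
                      - \sum_(0 <= k < n) r ^+ k.+1 * c k.+1.
      by rewrite /series /= big_nat_recl// expr0 mul1r addrK.
    rewrite (le_trans (ler_normB _ _))// addrC lerD2r.
    rewrite (le_trans (ler_norm_sum _ _ _))//.
    have -> : 2 * M * r = r * M * 2 by ring.
    apply: (@le_trans _ _ (r * M * \sum_(0 <= k < n) 2^-1 ^+ k)).
      rewrite mulr_sumr; apply: ler_sum => k _.
      rewrite normrM normrX (gtr0_norm r0) exprS -!mulrA.
      rewrite ler_wpM2l ?(ltW r0)// mulrC ler_pM ?exprn_ge0 ?(ltW r0)//.
      by rewrite lerXn2r// nnegrE ltW.
    rewrite ler_wpM2l ?mulr_ge0 ?(ltW r0)//.
    have -> : \sum_(0 <= k < n) 2^-1 ^+ k = 2 - 2 * 2^-1 ^+ n :> R.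
      elim: n => [|n ih]; first by rewrite big_geq// expr0; ring.
      by rewrite big_nat_recr//= ih exprS; field.
    by rewrite gerBl mulr_ge0// exprn_ge0.
  apply/ler_addgt0Pr => e e0.
  have [N _ hN] := @cvgr0_norm_lt _ R^o _ _ _ _ (cr r r0 r2) e e0.
  by rewrite (le_trans (h N))// lerD2l ltW// (hN N.+1 (leqnSn N)).
apply/eqP; rewrite -normr_le0; apply/ler_addgt0Pr => e e0; rewrite add0r.
have d0 : 0 < e / (2 * M + 1) by rewrite divr_gt0// ltr_wpDl// mulr_ge0.
have r0 : 0 < Num.min 2^-1 (e / (2 * M + 1)) by rewrite lt_min d0 invr_gt0 ltr0n.
rewrite (le_trans (key _ r0 _)) ?ge_min ?lexx//.
apply: (@le_trans _ _ (2 * M * (e / (2 * M + 1)))).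
  by rewrite ler_wpM2l ?mulr_ge0// ge_min lexx orbT.
by rewrite mulrCA ler_piMr ?(ltW e0)// ler_pdivrMr ?mul1r ?lerDl// ltr_wpDl// mulr_ge0.
Qed.

(** When the first coefficient vanishes, dividing by r gives the same hypothesis
    for the shifted sequence. *)
Lemma power_series_eq0 c M : (forall k, `|c k| <= M) ->
  (forall r, 0 < r -> r <= 2^-1 ->
     series (fun k => r ^+ k * c k) @ \oo --> (0 : R)) -> forall k, c k = 0.
Proof.
move=> cM cr k; elim: k c cM cr => [|k ih] c cM cr.
  exact: power_series_coef0 cM cr.
apply: (ih (fun k => c k.+1)) => // r r0 r2.
have c0 := power_series_coef0 cM cr.
have -> : series (fun k => r ^+ k * c k.+1) =
          (fun n => r^-1 * series (fun k => r ^+ k * c k) n.+1).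
  apply/funext => n; rewrite /series /= big_nat_recl// c0 mulr0 add0r mulr_sumr.
  by apply: eq_bigr => i _; rewrite exprS !mulrA mulVf ?mul1r// gt_eqF.
rewrite -[X in _ --> X](mulr0 r^-1); apply: cvgMl_tmp.
by rewrite (cvg_shiftS (series (fun k => r ^+ k * c k) : nat -> R^o)); exact: cr.
Qed.
End power_series.

(** * Quaternions and their coordinates *)

Section quaternions.
Context (R : realType).
Local Notation H := (quat R).
Implicit Types (x y z a : H).

(** The four real coordinates, as a predicate, so that statements about
    quaternions can be proved one coordinate at a time. *)
Inductive coordinate : (H -> R) -> Prop :=
| coordinate_re : coordinate (@qre R)
| coordinate_i : coordinate (@qi R)
| coordinate_j : coordinate (@qj R)
| coordinate_k : coordinate (@qk R).

Lemma coordinate_ext x y : (forall p, coordinate p -> p x = p y) -> x = y.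
Proof.
by move=> h; apply: quat_eqP; apply: h; constructor.
Qed.

Lemma coordinateD p x y : coordinate p -> p (x + y) = p x + p y.
Proof. by case. Qed.

Lemma coordinateZ p (r : R) x : coordinate p -> p (r *: x) = r * p x.
Proof. by case. Qed.

Lemma coordinate0 p : coordinate p -> p 0 = 0.
Proof. by case. Qed.

Lemma coordinateB p x y : coordinate p -> p (x - y) = p x - p y.
Proof. by case. Qed.

Lemma coordinate_sum p (I : Type) (s : seq I) (F : I -> H) : coordinate p ->
  p (\sum_(i <- s) F i) = \sum_(i <- s) p (F i).
Proof.
move=> cp; elim: s => [|i s ih]; first by rewrite !big_nil coordinate0.
by rewrite !big_cons coordinateD// ih.
Qed.

Lemma normq_sqr x : `|x| ^+ 2 = qre x ^+ 2 + qi x ^+ 2 + qj x ^+ 2 + qk x ^+ 2.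
Proof. by rewrite Defs.normqE sqr_sqrtr// !addr_ge0 ?sqr_ge0. Qed.

Lemma coordinate_le p x : coordinate p -> `|p x| <= `|x|.
Proof.
move=> cp; rewrite -(@ler_pXn2r _ 2) ?nnegrE// real_normK ?num_real// normq_sqr.
have := sqr_ge0 (qre x); have := sqr_ge0 (qi x); have := sqr_ge0 (qj x).
by have := sqr_ge0 (qk x); case: cp; lra.
Qed.

Lemma normqM x y : `|x * y| = `|x| * `|y|.
Proof.
apply/eqP; rewrite -(@eqrXn2 _ 2) ?mulr_ge0// exprMn !normq_sqr; apply/eqP.
by case: x => a b c d; case: y => e f g h /=; ring.
Qed.

Lemma normq1 : `|1 : H| = 1.
Proof. by apply/eqP; rewrite -(@eqrXn2 _ 2)// normq_sqr /=; apply/eqP; ring. Qed.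

Lemma normqX x n : `|x ^+ n| = `|x| ^+ n.
Proof. by elim: n => [|n ih]; rewrite ?expr0 ?normq1// !exprS normqM ih. Qed.

Lemma normq_conj x : `|quat_conj x| = `|x|.
Proof. by rewrite !Defs.normqE /= !sqrrN. Qed.

Lemma mul_conjq x : quat_conj x * x = (`|x| ^+ 2) *: 1.
Proof.
by apply: quat_eqP; rewrite /= ?mulr1 ?mulr0 ?normq_sqr; ring.
Qed.

Lemma quat_decomposition x : x = qre x *: 1 + qi x *: Quat 0 1 0 0
  + qj x *: Quat 0 0 1 0 + qk x *: Quat 0 0 0 1.
Proof. by apply: quat_eqP => /=; ring. Qed.

Lemma lipschitz_cvg (V : normedModType R) (F : H -> V) (K : R) (u : nat -> H) (l : H) :
  (forall x y, `|F x - F y| <= K * `|x - y|) ->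
  u n @[n --> \oo] --> l -> F (u n) @[n --> \oo] --> F l.
Proof.
move=> FK ul; apply/cvgrPdist_le => e e0.
have K0 : 0 < `|K| + 1 by rewrite ltr_wpDl.
have d0 : 0 < e / (`|K| + 1) by rewrite divr_gt0.
have [N _ hN] := @cvgr_dist_le _ _ _ _ _ u l ul _ d0.
exists N => // n Nn; rewrite (le_trans (FK _ _))//.
have := hN n Nn; rewrite /= ler_pdivlMr// mulrC; apply: le_trans.
by rewrite ler_wpM2r// (le_trans (ler_norm _))// lerDl.
Qed.

Lemma cvg_coordinate p (u : nat -> H) (l : H) : coordinate p ->
  u n @[n --> \oo] --> l -> p (u n) @[n --> \oo] --> p l.
Proof.
move=> cp; apply: (@lipschitz_cvg R^o p 1) => x y.
by rewrite mul1r -coordinateB//; exact: coordinate_le.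
Qed.

Lemma coordinate_cvg (u : nat -> H) (l : H) :
  (forall p, coordinate p -> p (u n) @[n --> \oo] --> p l) ->
  u n @[n --> \oo] --> l.
Proof.
move=> h; rewrite (quat_decomposition l).
rewrite (_ : u = fun n => qre (u n) *: 1 + qi (u n) *: Quat 0 1 0 0
  + qj (u n) *: Quat 0 0 1 0 + qk (u n) *: Quat 0 0 0 1); last first.
  by apply/funext => n; rewrite -quat_decomposition.
apply: cvgD; [apply: cvgD; [apply: cvgD|]|];
  by apply: cvgZr_tmp; apply: h; constructor.
Qed.

Lemma cvg_mulq a (u : nat -> H) (l : H) :
  u n @[n --> \oo] --> l -> u n * a @[n --> \oo] --> l * a.
Proof.
apply: (@lipschitz_cvg _ (fun x => x * a) `|a|) => x y.
by rewrite -mulrBl normqM mulrC.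
Qed.

Lemma cvg_quat_unique (u : nat -> H) (l m : H) :
  u n @[n --> \oo] --> l -> u n @[n --> \oo] --> m -> l = m.
Proof.
move=> ul um; apply: coordinate_ext => p cp.
by apply: (cvg_unique _ (cvg_coordinate cp ul) (cvg_coordinate cp um)).
Qed.

Lemma quat_normed_cvg (u : nat -> H) : cvgn (series (fun k => `|u k|)) ->
  cvgn (series u).
Proof.
move=> cu.
have cp p : coordinate p -> cvgn (series (fun k => p (u k))).
  move=> cp; apply: normed_cvg.
  apply: (@series_le_cvg _ _ (fun k => `|u k|)) => [n|n|n|]; last exact: cu.
  - exact: normr_ge0.
  - exact: normr_ge0.
  - exact: coordinate_le.
apply/cvg_ex; exists (Quat (limn (series (fun k => qre (u k))))
  (limn (series (fun k => qi (u k)))) (limn (series (fun k => qj (u k))))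
  (limn (series (fun k => qk (u k))))).
apply: coordinate_cvg => p cp'.
under eq_fun do rewrite /series /= coordinate_sum//.
by have := cp p cp'; case: cp'.
Qed.

End quaternions.

(** * Integration of quaternion-valued functions *)

Section quaternion_integral.
Context (R : realType).
Local Notation H := (quat R).
Local Notation mu := (@lebesgue_measure R).
Implicit Types (f g : R -> H).

Lemma quat_integrableP f : quat_integrable f <->
  forall p, coordinate p -> rintegrable mu (fun x => p (f x)).
Proof.
split=> [[h1 h2 h3 h4] p []//|h].
by split; [exact: h (coordinate_re R)|exact: h (coordinate_i R)|
  exact: h (coordinate_j R)|exact: h (coordinate_k R)].
Qed.

Lemma coordinate_integral p f : coordinate p ->
  p (quat_integral f) = \int[mu]_x p (f x).
Proof. by case. Qed.

(** A real-linear functional is a combination of the four coordinates. *)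
Lemma quat_integral_linear (l : H -> R) f :
  (forall x y, l (x + y) = l x + l y) -> (forall c x, l (c *: x) = c * l x) ->
  quat_integrable f ->
  rintegrable mu (fun x => l (f x)) /\ \int[mu]_x l (f x) = l (quat_integral f).
Proof.
move=> lD lZ [h1 h2 h3 h4].
have lE z : l z = l 1 * qre z + l (Quat 0 1 0 0) * qi z
   + l (Quat 0 0 1 0) * qj z + l (Quat 0 0 0 1) * qk z.
  by rewrite [in LHS](quat_decomposition z) !lD !lZ; ring.
have i1 : rintegrable mu (fun x => l 1 * qre (f x)) by exact: rintegrableZ.
have i2 : rintegrable mu (fun x => l (Quat 0 1 0 0) * qi (f x)) by exact: rintegrableZ.
have i3 : rintegrable mu (fun x => l (Quat 0 0 1 0) * qj (f x)) by exact: rintegrableZ.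
have i4 : rintegrable mu (fun x => l (Quat 0 0 0 1) * qk (f x)) by exact: rintegrableZ.
have i12 := rintegrableD i1 i2; have i123 := rintegrableD i12 i3.
under eq_fun do rewrite lE.
split; first exact: rintegrableD.
rewrite RintD// RintD// RintD// !RintZ//.
by rewrite [RHS]lE.
Qed.

Lemma quat_integrableMr f a : quat_integrable f -> quat_integrable (fun x => f x * a).
Proof.
move=> fi; apply/quat_integrableP => p cp.
apply: (quat_integral_linear (l := fun z => p (z * a)) _ _ fi).1.
  by move=> x y; rewrite mulrDl coordinateD.
by move=> c x; rewrite -scalerAl coordinateZ.
Qed.

Lemma quat_integralMr f a : quat_integrable f ->
  quat_integral (fun x => f x * a) = quat_integral f * a.
Proof.
move=> fi; apply: coordinate_ext => p cp; rewrite coordinate_integral//.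
apply: (quat_integral_linear (l := fun z => p (z * a)) _ _ fi).2.
  by move=> x y; rewrite mulrDl coordinateD.
by move=> c x; rewrite -scalerAl coordinateZ.
Qed.

Lemma quat_integralD f g : quat_integrable f -> quat_integrable g ->
  quat_integral (fun x => f x + g x) = quat_integral f + quat_integral g.
Proof.
move=> /quat_integrableP fi /quat_integrableP gi; apply: coordinate_ext => p cp.
rewrite coordinateD// !coordinate_integral// -RintD; [|exact: fi|exact: gi].
by apply: eq_Rintegral => x _; rewrite coordinateD.
Qed.

Lemma L2_coordinate f p : L2 f -> coordinate p -> sqint mu (fun x => p (f x)).
Proof.
move=> [mf foo] cp.
have mp : measurable_fun setT (fun x => p (f x)) by case: mf; case: cp.
split=> //; apply: ge0_rintegrable; first exact: measurable_funX.
  by move=> x; exact: sqr_ge0.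
apply: le_lt_trans foo; apply: ge0_le_integral => //.
- by move=> x _; rewrite lee_fin sqr_ge0.
- by apply/measurable_EFinP; exact: measurable_funX.
- apply/measurable_EFinP; under eq_fun do rewrite normq_sqr.
  case: mf => m1 m2 m3 m4.
  by apply: measurable_funD; [apply: measurable_funD; [apply: measurable_funD|]|];
    exact: measurable_funX.
- move=> x _; rewrite lee_fin -[leLHS]real_normK ?num_real//.
  by rewrite lerXn2r ?nnegrE// coordinate_le.
Qed.

Lemma rintegrable_L2 f : L2 f -> rintegrable mu (fun x => `|f x| ^+ 2).
Proof.
move=> f2; under eq_fun do rewrite normq_sqr.
have h p cp := (@L2_coordinate f p f2 cp).2.
apply: rintegrableD; [apply: rintegrableD; [apply: rintegrableD|]|]; apply: h; constructor.
Qed.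

Lemma Rint_L2 f : L2 f -> \int[mu]_x (`|f x| ^+ 2) =
  \int[mu]_x (qre (f x) ^+ 2) + \int[mu]_x (qi (f x) ^+ 2)
  + \int[mu]_x (qj (f x) ^+ 2) + \int[mu]_x (qk (f x) ^+ 2).
Proof.
move=> f2; under eq_Rintegral do rewrite normq_sqr.
have h p cp := (@L2_coordinate f p f2 cp).2.
have h1 := h _ (coordinate_re R); have h2 := h _ (coordinate_i R).
have h3 := h _ (coordinate_j R); have h4 := h _ (coordinate_k R).
have h12 := rintegrableD h1 h2; have h123 := rintegrableD h12 h3.
by rewrite RintD// RintD// RintD.
Qed.

Lemma L2_of_coordinates f :
  (forall p, coordinate p -> sqint mu (fun x => p (f x))) -> L2 f.
Proof.
move=> h; split.
  by split; [exact: (h _ (coordinate_re R)).1|exact: (h _ (coordinate_i R)).1|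
    exact: (h _ (coordinate_j R)).1|exact: (h _ (coordinate_k R)).1].
apply: ge0_rintegrable_lty; first by move=> x; rewrite exprn_ge0.
under eq_fun do rewrite normq_sqr.
by apply: rintegrableD; [apply: rintegrableD; [apply: rintegrableD|]|]; apply: (h _ _).2; constructor.
Qed.

End quaternion_integral.

(** * Clifford-Appell polynomials and Fock coefficients *)

Section clifford_appell.
Context (R : realType).
Local Notation H := (quat R).
Implicit Types (q : H) (k : nat).

Lemma Tcoef_ge0 k j : 0 <= Tcoef R k j.
Proof. by rewrite /Tcoef divr_ge0. Qed.

Lemma sum_Tcoef k : \sum_(j < k.+1) Tcoef R k j = 1.
Proof.
have e : (\sum_(j < k.+1) 2 * (k - j + 1) = (k + 1) * (k + 2))%N.
  elim: k => [|k ih]; first by rewrite big_ord1.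
  rewrite big_ord_recl; under eq_bigr do rewrite lift0 subSS.
  by rewrite ih subn0; ring.
by rewrite /Tcoef -mulr_suml -natr_sum e divff// pnatr_eq0.
Qed.

(** Conjugation preserves the multiplicative norm, and the coefficients are
    nonnegative with sum 1. *)
Lemma Qpoly_norm k q : `|Qpoly k q| <= `|q| ^+ k.
Proof.
rewrite /Qpoly (le_trans (ler_norm_sum _ _ _))//.
rewrite -[leRHS]mul1r -(sum_Tcoef k) mulr_suml; apply: ler_sum => j _.
rewrite normrZ ger0_norm ?Tcoef_ge0// normqM !normqX normq_conj -exprD.
by rewrite subnK// -ltnS.
Qed.

(** Real numbers are self-conjugate, and the coefficients sum to 1. *)
Lemma Qpoly_real k (r : R) : Qpoly k (r *: 1 : H) = r ^+ k *: 1.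
Proof.
have cr : quat_conj (r *: 1 : H) = r *: 1.
  by apply: quat_eqP => //=; rewrite mulr0 oppr0.
rewrite /Qpoly cr -[RHS]scale1r -(sum_Tcoef k) scaler_suml; apply: eq_bigr => j _.
rewrite -exprD subnK; last by rewrite -ltnS.
by rewrite exprZn expr1n.
Qed.

(** On the real axis both expansions are power series, with coefficients that
    the Fock condition bounds. *)
Lemma fock_expansion_unique (f : H -> H) (a b : nat -> H) :
  fock_expansion f a -> fock_expansion f b -> a = b.
Proof.
move=> [a2 af] [b2 bf]; apply/funext => k; apply: coordinate_ext => p cp.
apply/eqP; rewrite -subr_eq0 -coordinateB//; apply/eqP.
have bound (c : nat -> H) : (\sum_(0 <= k <oo) (k`!%:R * `|c k| ^+ 2)%:E < +oo)%E ->
    exists M, forall k, `|c k| <= M.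
  move=> c2; have := nnseries_is_cvg (u := fun k => k`!%:R * `|c k| ^+ 2) _ c2.
  move=> /(_ _)/cvg_series_bounded/bounded_fun_has_ubound[|M hM].
    by move=> i; rewrite mulr_ge0// exprn_ge0.
  exists (1 + M) => i; have h : i`!%:R * `|c i| ^+ 2 <= M by apply: hM; exists i.
  have f1 : 1 <= i`!%:R :> R by rewrite ler1n fact_gt0.
  have c20 := sqr_ge0 `|c i|; have := sqr_ge0 (`|c i| - 1).
  rewrite sqrrB1; nra.
have [Ma hMa] := bound _ a2; have [Mb hMb] := bound _ b2.
move: k; apply: (@power_series_eq0 _ (fun k => p (a k - b k)) (Ma + Mb)).
  move=> k; rewrite (le_trans (coordinate_le _ cp))// (le_trans (ler_normB _ _))//.
  exact: lerD.
move=> r _ _.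
have := cvg_coordinate cp (cvgB (af (r *: 1)) (bf (r *: 1))).
rewrite subrr coordinate0// => h.
suff -> : series (fun k => r ^+ k * p (a k - b k)) =
  (fun n => p ((series (fun k => Qpoly k (r *: 1) * a k) -
                series (fun k => Qpoly k (r *: 1) * b k)) n)) by exact: h.
apply/funext => n; rewrite -[X in p X]/(series _ n - series _ n) coordinateB// /series /=.
rewrite !coordinate_sum// -sumrB; apply: eq_bigr => k _.
by rewrite Qpoly_real -!scalerAl !mul1r !coordinateZ// coordinateB// mulrBr.
Qed.

Lemma fock_coefE (f : H -> H) (a : nat -> H) : fock_expansion f a -> fock_coef f = a.
Proof.
move=> fa; apply: fock_expansion_unique (fa).
by rewrite /fock_coef; apply: getPex; exists a.
Qed.

End clifford_appell.

(** * The transform *)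

Section transform.
Context (R : realType).
Local Notation H := (quat R).
Local Notation mu := (@lebesgue_measure R).
Local Notation eta := (@hermite_fun R).
Implicit Types (phi psi : R -> H) (q : H) (x : R) (k : nat).

Lemma sqrt_fact_gt0 k : 0 < Num.sqrt (k`!%:R) :> R.
Proof. by rewrite sqrtr_gt0 ltr0n fact_gt0. Qed.

Lemma kernel_term_norm q x k :
  `|kernel_term q x k| <= `|eta k x| * (`|q| ^+ k / Num.sqrt k`!%:R).
Proof.
rewrite /kernel_term normrZ normrM normfV (gtr0_norm (sqrt_fact_gt0 k)).
by rewrite -mulrA ler_wpM2l// mulrC ler_wpM2r ?Qpoly_norm// invr_ge0.
Qed.

(** At fixed x the Hermite functions grow at most geometrically, which the
    factor 1 / sqrt k! compensates. *)
Lemma kernel_cvg q x : cvgn (series (kernel_term q x)).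
Proof.
apply: quat_normed_cvg.
have r0 : 0 <= (2 * `|x| + 1) * `|q| by rewrite mulr_ge0// addr_ge0// mulr_ge0.
have cs := is_cvg_seriesMl (c := `|eta 0 x|) (cvg_series_sqrt_fact r0).
apply: series_le_cvg cs => [k|k|k].
- exact: normr_ge0.
- apply: mulr_ge0; first exact: normr_ge0.
  by apply: divr_ge0; [exact: exprn_ge0|exact: sqrtr_ge0].
- apply: (le_trans (kernel_term_norm q x k)).
  rewrite /= exprMn !mulrA -[leLHS]mulrA -[leRHS]mulrA.
  by rewrite ler_wpM2r ?hermite_fun_bound.
Qed.

Definition hermite_coeff phi k : H := quat_integral (fun x => eta k x *: phi x).

(** These will be the coefficients of the transform of phi. *)
Definition fock_coeff phi k : H := (Num.sqrt k`!%:R)^-1 *: hermite_coeff phi k.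

Lemma integrable_hermite phi k : L2 phi ->
  quat_integrable (fun x => eta k x *: phi x).
Proof.
move=> f2; apply/quat_integrableP => p cp.
under eq_fun do rewrite coordinateZ//.
by apply: rintegrable_sqintM; [exact: sqint_hermite|exact: L2_coordinate].
Qed.

Lemma coordinate_hermite_coeff p phi k : coordinate p ->
  p (hermite_coeff phi k) = coef mu eta (fun x => p (phi x)) k.
Proof.
move=> cp; rewrite coordinate_integral//; apply: eq_Rintegral => x _.
by rewrite coordinateZ.
Qed.

(** The kernel may be integrated termwise because the integrals of the norms of
    its terms against phi are, up to a constant, at most |q|^k / sqrt k!. *)
Lemma transform_expansion phi q : L2 phi ->
  quat_integrable (fun x => kernelA q x * phi x) /\
  series (fun k => Qpoly k q * fock_coeff phi k) @ \oo --> transformB phi q.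
Proof.
move=> f2.
pose s k : R := `|q| ^+ k / Num.sqrt k`!%:R.
have s0 k : 0 <= s k by rewrite divr_ge0 ?exprn_ge0 ?sqrtr_ge0.
have main p : coordinate p ->
    rintegrable mu (fun x => p (kernelA q x * phi x)) /\
    series (fun k => p (Qpoly k q * fock_coeff phi k)) @ \oo -->
    \int[mu]_x p (kernelA q x * phi x).
  move=> cp; pose F k x := p (kernel_term q x k * phi x).
  pose l k z := p (Qpoly k q * ((Num.sqrt k`!%:R)^-1 *: z)).
  have FE k x : F k x = l k (eta k x *: phi x).
    by rewrite /F /l /kernel_term scalerA [in RHS]mulrC -scalerAr scalerAl.
  have lD k u v : l k (u + v) = l k u + l k v.
    by rewrite /l scalerDr mulrDr coordinateD.
  have lZ k c u : l k (c *: u) = c * l k u.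
    by rewrite /l scalerA mulrC -scalerA -scalerAr coordinateZ.
  have hk k := quat_integral_linear (lD k) (lZ k) (integrable_hermite k f2).
  have iF k : rintegrable mu (F k).
    have [+ _] := hk k; rewrite (_ : F k = fun x => l k (eta k x *: phi x))//.
    by apply/funext => x; rewrite FE.
  have IF k : \int[mu]_x F k x = p (Qpoly k q * fock_coeff phi k).
    have [_ e] := hk k; rewrite -[RHS]/(l k (hermite_coeff phi k)) -[RHS]e.
    by apply: eq_Rintegral => x _; rewrite FE.
  have FB k x : `|F k x| <= s k * (eta k x ^+ 2 + `|phi x| ^+ 2).
    rewrite (le_trans (coordinate_le _ cp))// normqM.
    apply: (le_trans (ler_wpM2r (normr_ge0 _) (kernel_term_norm q x k))).
    rewrite -/(s k) mulrAC mulrC ler_wpM2l// -[X in _ <= X + _]real_normK ?num_real//.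
    have := sqr_ge0 (`|eta k x| - `|phi x|); rewrite sqrrB.
    have := sqr_ge0 `|eta k x|; have := sqr_ge0 `|phi x|; lra.
  have iB k : rintegrable mu (fun x => s k * (eta k x ^+ 2 + `|phi x| ^+ 2)).
    by apply/rintegrableZ/rintegrableD; [case: (@sqint_hermite R k)|exact: rintegrable_L2].
  have [] := @Rint_series _ _ _ mu F (fun x => p (kernelA q x * phi x)) iF.
  - have cs := is_cvg_seriesMl (c := 1 + \int[mu]_x (`|phi x| ^+ 2))
      (cvg_series_sqrt_fact (normr_ge0 q)).
    apply: series_le_cvg cs => [k|k|k].
    + by apply: Rintegral_ge0 => x _; exact: normr_ge0.
    + apply: mulr_ge0; last exact: s0.
      by apply: addr_ge0 => //; apply: Rintegral_ge0 => x _; exact: exprn_ge0.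
    + apply: (le_trans (le_Rint (rintegrable_norm (iF k)) (iB k) (FB k))).
      have i1 : rintegrable mu (fun x => eta k x ^+ 2) by case: (@sqint_hermite R k).
      rewrite RintZ; last by apply: rintegrableD => //; exact: rintegrable_L2.
      rewrite RintD//; last exact: rintegrable_L2.
      under eq_Rintegral do rewrite expr2.
      by rewrite hermite_orthonormal eqxx [leRHS]mulrC.
  - move=> x; have := cvg_coordinate cp (cvg_mulq (a := phi x) (@kernel_cvg q x)).
    rewrite -/(kernelA q x) (_ : (fun n => p (series (kernel_term q x) n * phi x)) =
      series (F ^~ x))//.
    by apply/funext => n; rewrite /series /= mulr_suml coordinate_sum.
  move=> hi; rewrite (_ : (fun k => \int[mu]_x F k x) =
    (fun k => p (Qpoly k q * fock_coeff phi k)))//.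
  by apply/funext => k.
split; first by apply/quat_integrableP => p /main[].
apply: coordinate_cvg => p cp; rewrite coordinate_integral//.
under eq_fun do rewrite /series /= coordinate_sum//.
by have [_] := main p cp.
Qed.

Lemma fock_weight phi k :
  k`!%:R * `|fock_coeff phi k| ^+ 2 = `|hermite_coeff phi k| ^+ 2.
Proof.
rewrite /fock_coeff normrZ normfV (gtr0_norm (sqrt_fact_gt0 k)) exprMn exprVn.
by rewrite sqr_sqrtr// mulrA mulfV ?mul1r// pnatr_eq0 -lt0n fact_gt0.
Qed.

(** Parseval's identity, coordinate by coordinate. *)
Lemma hermite_coeff_parseval phi : L2 phi ->
  series (fun k => `|hermite_coeff phi k| ^+ 2) @ \oo -->
  \int[mu]_x (`|phi x| ^+ 2).
Proof.
move=> f2; rewrite Rint_L2//.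
pose c p k := coef mu eta (fun x => p (phi x)) k ^+ 2.
have -> : series (fun k => `|hermite_coeff phi k| ^+ 2) =
  series (c (@qre R)) + series (c (@qi R)) + series (c (@qj R)) + series (c (@qk R)).
  rewrite -!seriesD; congr series; apply/funext => k; rewrite normq_sqr.
  by rewrite !coordinate_hermite_coeff//; constructor.
have h p (cp : coordinate p) := hermite_parseval (L2_coordinate f2 cp).
by apply: cvgD; [apply: cvgD; [apply: cvgD|]|]; apply: h; constructor.
Qed.

Lemma transform_fock_expansion phi : L2 phi ->
  fock_expansion (transformB phi) (fock_coeff phi).
Proof.
move=> f2; split; last by move=> q; exact: (transform_expansion q f2).2.
under eq_eseriesr do rewrite fock_weight.
rewrite nneseries_EFin ?ltry//.
by apply/cvg_ex; eexists; exact: hermite_coeff_parseval.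
Qed.

Lemma fock_norm_transform phi : L2 phi -> fock_norm (transformB phi) = L2_norm phi.
Proof.
move=> f2; congr Num.sqrt.
rewrite /fock_inner (fock_coefE (transform_fock_expansion f2)).
set u := series _.
have cu : u @ \oo --> (\int[mu]_x (`|phi x| ^+ 2)) *: (1 : H).
  have -> : u = (fun n => series (fun k => `|hermite_coeff phi k| ^+ 2) n *: (1 : H)).
    apply/funext => n; rewrite /u /series /= scaler_suml; apply: eq_bigr => k _.
    by rewrite mul_conjq scalerA fock_weight.
  by apply: cvgZr_tmp; exact: hermite_coeff_parseval.
by rewrite (cvg_lim _ cu)//= mulr1.
Qed.

Lemma transform_linear phi psi (a b : H) : L2 phi -> L2 psi ->
  transformB (fun x => phi x * a + psi x * b) =
  (fun q => transformB phi q * a + transformB psi q * b).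
Proof.
move=> f2 g2; apply/funext => q.
have [fi _] := transform_expansion q f2; have [gi _] := transform_expansion q g2.
rewrite /transformB -!quat_integralMr// -quat_integralD; [|exact: quat_integrableMr..].
by congr quat_integral; apply/funext => x; rewrite mulrDr !mulrA.
Qed.

Lemma transform_ae_eq phi psi : L2 phi -> L2 psi ->
  phi = psi %[ae mu] -> transformB phi = transformB psi.
Proof.
move=> f2 g2 fg; apply/funext => q; apply: coordinate_ext => p cp.
have [/quat_integrableP/(_ p cp) fi _] := transform_expansion q f2.
have [/quat_integrableP/(_ p cp) gi _] := transform_expansion q g2.
rewrite !coordinate_integral//; apply: Rint_ae_eq.
- exact: rintegrable_measurable fi.
- exact: rintegrable_measurable gi.
- by apply: (@filterS _ _ (ae_filter_ringOfSetsType mu)) fg => x + _ => /(_ I) ->.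
Qed.

(** Equal transforms have the same Fock coefficients, hence phi and psi have the
    same Hermite coefficients in each coordinate. *)
Lemma transform_injective phi psi : L2 phi -> L2 psi ->
  transformB phi = transformB psi -> phi = psi %[ae mu].
Proof.
move=> f2 g2 e.
have ec k : hermite_coeff phi k = hermite_coeff psi k.
  have := fock_expansion_unique (transform_fock_expansion f2)
    (eq_rect_r (fun f => fock_expansion f _) (transform_fock_expansion g2) e).
  move=> /(congr1 (fun a => a k)) /(congr1 (fun z => Num.sqrt k`!%:R *: z)).
  by rewrite /fock_coeff !scalerA mulfV ?scale1r// gt_eqF ?sqrt_fact_gt0.
have h p : coordinate p -> (fun x => p (phi x)) = (fun x => p (psi x)) %[ae mu].
  move=> cp; have p2 := L2_coordinate f2 cp; have q2 := L2_coordinate g2 cp.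
  have := hermite_complete (sqintB p2 q2).
  have z k : coef mu eta (fun x => p (phi x) - p (psi x)) k = 0.
    by rewrite (coefB (@sqint_hermite R))// -!coordinate_hermite_coeff// ec subrr.
  move=> /(_ z); apply: (@filterS _ _ (ae_filter_ringOfSetsType mu)) => x + _ => /(_ I) /eqP.
  by rewrite subr_eq0 => /eqP.
have F := ae_filter_ringOfSetsType mu.
apply: (@filterS _ _ F) (@filterI _ _ F _ _ (@filterI _ _ F _ _ (h _ (coordinate_re R))
  (h _ (coordinate_i R))) (@filterI _ _ F _ _ (h _ (coordinate_j R)) (h _ (coordinate_k R)))).
by move=> x [[h1 h2] [h3 h4]] _; apply: quat_eqP; [exact: h1|exact: h2|exact: h3|exact: h4].
Qed.

(** Riesz-Fischer provides each coordinate of a preimage, from the coefficients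
    sqrt k! a_k. *)
Lemma transform_surjective (f : H -> H) : fock f ->
  exists2 phi, L2 phi & transformB phi = f.
Proof.
move=> [a fa]; have [a2 af] := fa.
have ca := nnseries_is_cvg (u := fun k => k`!%:R * `|a k| ^+ 2) _ a2.
have {}ca : cvgn (series (fun k => k`!%:R * `|a k| ^+ 2)).
  by apply: ca => k; rewrite mulr_ge0// exprn_ge0.
pose b k := Num.sqrt k`!%:R *: a k.
have h p : coordinate p -> exists2 g, sqint mu g & forall k, coef mu eta g k = p (b k).
  move=> cp; apply: hermite_riesz_fischer; apply: series_le_cvg ca => k.
  - exact: sqr_ge0.
  - by rewrite mulr_ge0// exprn_ge0.
  - rewrite -[leLHS]real_normK ?num_real//.
    apply: (@le_trans _ _ (`|b k| ^+ 2)); first by rewrite lerXn2r ?nnegrE// coordinate_le.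
    by rewrite /b normrZ exprMn real_normK ?num_real// sqr_sqrtr.
have [g1 s1 c1] := h _ (coordinate_re R); have [g2 s2 c2] := h _ (coordinate_i R).
have [g3 s3 c3] := h _ (coordinate_j R); have [g4 s4 c4] := h _ (coordinate_k R).
pose phi x := Quat (g1 x) (g2 x) (g3 x) (g4 x).
have f2 : L2 phi by apply: L2_of_coordinates => p [].
have bE k : hermite_coeff phi k = b k.
  apply: coordinate_ext => p cp; rewrite coordinate_hermite_coeff//.
  by case: cp.
have aE : fock_coeff phi = a.
  by apply/funext => k; rewrite /fock_coeff bE /b scalerA mulVf ?scale1r.
exists phi => //; apply/funext => q.
have [_ +] := transform_expansion q f2; rewrite aE => cB.
exact: cvg_quat_unique cB (af q).
Qed.

End transform.

Theorem theorem4p13 (R : realType) :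
  (* the kernel and the transform are well defined *)
  (forall (q : quat R) (x : R), cvgn (series (kernel_term q x))) /\
  (forall (phi : R -> quat R), L2 phi ->
    forall q, quat_integrable (fun x => kernelA q x * phi x)) /\
  (* the transform maps L^2 classes to the Fock space *)
  (forall phi psi : R -> quat R, L2 phi -> L2 psi ->
    phi = psi %[ae (@lebesgue_measure R)] -> transformB phi = transformB psi) /\
  (forall phi : R -> quat R, L2 phi -> fock (transformB phi)) /\
  (* right H-linearity *)
  (forall (phi psi : R -> quat R) (a b : quat R), L2 phi -> L2 psi ->
    transformB (fun x => phi x * a + psi x * b) =
    (fun q => transformB phi q * a + transformB psi q * b)) /\
  (* isometry *)
  (forall phi : R -> quat R, L2 phi ->
    fock_norm (transformB phi) = L2_norm phi) /\
  (* bijectivity from L^2 classes onto the Fock space *)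
  (forall phi psi : R -> quat R, L2 phi -> L2 psi ->
    transformB phi = transformB psi ->
    phi = psi %[ae (@lebesgue_measure R)]) /\
  (forall f : quat R -> quat R, fock f ->
    exists2 phi : R -> quat R, L2 phi & transformB phi = f).
Proof.
split; first exact: kernel_cvg.
split; first by move=> phi f2 q; exact: (transform_expansion q f2).1.
split; first exact: transform_ae_eq.
split; first by move=> phi /transform_fock_expansion fa; exists (fock_coeff phi).
split; first by move=> phi psi a b f2 g2; exact: transform_linear.
split; first exact: fock_norm_transform.
split; first exact: transform_injective.
exact: transform_surjective.
Qed.
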